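(* Let $H=H_1\oplus H_2$ be an orthogonal direct sum of separable Hilbert spaces $H_1,H_2$, and let $\mu$ be a Gaussian measure on $H$ with mean $m$ and covariance operator $C$. Then there is a regular conditional probability $(\mu_t)_{t\in H_2}$ of $\mu$ given the $H_2$-component such that, for all $t\in H_2$, the conditional measure $\mu_t$ is a Gaussian measure on $H$ with covariance operator $\mathcal{H}_1(C)$, the short of $C$ to the subspace $H_1$.
   Context: Hilbert spaces are real. A Borel probability measure $\mu$ on a Hilbert space $H$ is Gaussian if for each $h\in H$ the pushforward of $\mu$ under $x\mapsto\langle h,x\rangle$ is a Gaussian measure on $\mathbb{R}$, where Dirac measures count as Gaussian. Its mean $m\in H$ is defined by $\langle h,m\rangle=\int_H\langle h,x\rangle\,d\mu(x)$ for all $h\in H$, and its covariance operator $C:H\to H$ by $\langle Ch_1,h_2\rangle=\int_H\langle h_1,x\rangle\langle h_2,x\rangle\,d\mu(x)-\langle h_1,m\rangle\langle h_2,m\rangle$ for all $h_1,h_2\in H$. These are well defined, and $C$ is a positive trace class operator. Conditional measures: let $\Pi_2:H\to H_2$ be the orthogonal projection viewed as a map onto $H_2$, and $\nu=(\Pi_2)_*\mu$. A regular conditional probability of $\mu$ given the $H_2$-component is a family $(\mu_t)_{t\in H_2}$ of Borel probability measures on $H$ such that $t\mapsto\mu_t(A)$ is measurable for every Borel $A\subset H$, and $\mu(A\cap\Pi_2^{-1}(B))=\int_B\mu_t(A)\,d\nu(t)$ for all Borel $A\subset H$, $B\subset H_2$. Such a family exists and is unique up to $\nu$-null sets of $t$.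 Shorted operator: a bounded symmetric operator $A$ on $H$ is positive if $\langle Ax,x\rangle\ge 0$ for all $x\in H$; $L_+(H)$ denotes the set of positive operators, and $X\leqq A$ means that $A-X$ is positive. For a closed subspace $S\subset H$ and $A\in L_+(H)$, the set $\{X\in L_+(H): X\leqq A,\ R(X)\subset S\}$, where $R(X)$ is the range of $X$, has a maximal (greatest) element with respect to $\leqq$, called the short of $A$ to $S$ and denoted $\mathcal{S}(A)$. For $S=H_1$ (so $S^\perp=H_2$) it is denoted $\mathcal{H}_1(A)$. *)

(* Defs.v *)
From HB Require Import structures.
From mathcomp Require Import all_boot all_order all_algebra.
From mathcomp Require Import all_classical all_reals all_analysis.
From mathcomp Require Import measurable_realfun.
Import Order.TTheory GRing.Theory Num.Theory.
Import numFieldNormedType.Exports.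

Set Implicit Arguments.
Unset Strict Implicit.
Unset Printing Implicit Defensive.

Local Open Scope classical_set_scope.
Local Open Scope ring_scope.

HB.mixin Record CompleteNormedModule_isHilbert (R : realType) H
    of CompleteNormedModule R H := {
  inner : {dot H for idfun} ;
  innerxx : forall x : H, inner x x = `|x| ^+ 2 }.

#[short(type="hilbertType")]
HB.structure Definition Hilbert (R : realType) :=
  {H of CompleteNormedModule R H & CompleteNormedModule_isHilbert R H}.

Definition borel {R : realType} (H : hilbertType R) :=
  g_sigma_algebraType (@open H).

Section subspaces.
Context {R : realType} {H : hilbertType R}.
Implicit Types S : set H.

Definition closed_subspace S :=
  [/\ closed S, S 0 & forall (a : R) x y, S x -> S y -> S (a *: x + y)].

Definition separable S :=
  exists D : set H, [/\ countable D, D `<=` S & S `<=` closure D].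

(* Closed subspaces of a Hilbert space are Hilbert spaces themselves, and the
   orthogonal sum is taken internally. *)
Definition orthogonal_direct_sum (H1 H2 : set H) :=
  [/\ closed_subspace H1, closed_subspace H2,
      forall x y, H1 x -> H2 y -> inner x y = 0 &
      forall z, exists x y, [/\ H1 x, H2 y & z = x + y]].

(* When S is a closed subspace such a y exists and is unique; the default
   value 0 of xget is then never used. *)
Definition orth_proj S (x : H) : H :=
  xget 0 [set y | S y /\ forall z, S z -> inner (x - y) z = 0].

End subspaces.

Section operators.
Context {R : realType} {H : hilbertType R}.
Implicit Types A X Y : H -> H.

Definition bounded_operator A :=
  linear A /\ exists M : R, forall x, `|A x| <= M * `|x|.

Definition positive_operator A :=
  [/\ bounded_operator A,
      forall x y, inner (A x) y = inner x (A y) &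
      forall x, 0 <= inner (A x) x].

Definition op_le X A := positive_operator (fun x => A x - X x).

Definition short_set (S : set H) A : set (H -> H) :=
  [set X | [/\ positive_operator X, op_le X A & range X `<=` S]].

Definition is_short (S : set H) A X :=
  short_set S A X /\ forall Y, short_set S A Y -> op_le Y X.

(* The greatest element of short_set S A exists and is unique when A is
   positive and S is a closed subspace; the default value of xget is then
   never used. *)
Definition short (S : set H) A : H -> H :=
  xget (fun=> 0) [set X | is_short S A X].

End operators.

Section gaussian.
Context {R : realType}.

(* The library's normal_prob m s has standard deviation s, and is a uniform
   law instead of a Dirac measure when s = 0. *)
Definition gaussian_real (nu : set R -> \bar R) :=
  (exists a : R, forall B : set R, measurable B -> nu B = \d_a B) \/
  (exists m s : R, 0 < s /\
     forall B : set R, measurable B -> nu B = normal_prob m s B).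

Context {H : hilbertType R}.
Implicit Types mu : probability (borel H) R.

Definition gaussian_measure mu :=
  forall h : H, gaussian_real (pushforward mu (fun x : H => inner h x)).

(* An integral equal to a real number is that of an integrable function, since
   +oo - oo = -oo in \bar R. *)
Definition is_mean mu (m : H) :=
  forall h : H, (\int[mu]_x (inner h x)%:E = (inner h m)%:E)%E.

Definition is_covariance mu (C : H -> H) :=
  exists2 m : H, is_mean mu m &
    forall h1 h2 : H,
      ((inner (C h1) h2)%:E =
       \int[mu]_x (inner h1 x * inner h2 x)%:E
         - (inner h1 m * inner h2 m)%:E)%E.

(* The family is indexed by H, but only its members with index in H2 matter.
   As H2 is closed, its Borel sets are the Borel sets of H included in H2. *)
Definition regular_conditional_probability mu (H2 : set H)
    (mu_ : H -> probability (borel H) R) :=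
  (forall A : set (borel H), measurable A ->
     measurable_fun (H2 : set (borel H)) (fun t : borel H => mu_ t A)) /\
  (forall A B : set (borel H), measurable A -> measurable B -> B `<=` H2 ->
     mu (A `&` orth_proj H2 @^-1` B) =
     (\int[pushforward mu (orth_proj H2 : borel H -> borel H)]_(t in B) mu_ t A)%E).

End gaussian.

(* Main.v *)
Require Import Defs.
From HB Require Import structures.
From mathcomp Require Import all_boot all_order all_algebra.
From mathcomp Require Import all_classical all_reals all_analysis.
From mathcomp Require Import measurable_realfun.
From mathcomp Require Import ring lra.
Import Order.TTheory GRing.Theory Num.Theory.
Import numFieldNormedType.Exports.

(** Let [P] be the orthogonal projection onto [H2]. The conditional measure at
    [t] is obtained by splitting [x - m] into a part that is a function of its
    observed component [P (x - m)] and a remainder that is independent of it: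
    conditioning on the observation freezes the first part, and leaves the law
    of the second one unchanged.

    The first part is a regression. For the covariance form [<C h, k>], which is
    only semidefinite, the Gram-Schmidt process applied to a dense sequence of
    [H2] gives vectors [k_i] of [H2] such that the variables [<k_i, x - m>] are
    uncorrelated, with variance one or identically null. The regression of
    [x - m] is the series of the vectors [<k_i, x - m> C k_i]. Bessel's
    inequality bounds the sum of the [`|C k_i| ^+ 2] by the expectation of
    [`|x - m| ^+ 2] ([gs_variance_sum]), so that a subsequence of partial sums
    converges almost everywhere; replacing the sums by zero elsewhere gives an
    everywhere defined measurable map [Lam] that only depends on the coordinates
    [<k_i, w>] of its argument [w], hence on [P w] ([regression_limit]). This
    requires the second moment of a Gaussian measure to be finite, which is
    proved by playing the fourth moments of the one-dimensional marginals
    against the small probability of the complement of a large ball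
    ([second_moment_integrable]).

    The remainder [z = x - m - Lam (x - m)] is, in each direction [h], the
    almost everywhere limit of [<r_n h, x - m>], where [r_n h] is the [n]-th
    Gram-Schmidt residue of [h]. By dominated convergence the characteristic
    function of the pair of [z] and the observation is the limit of Gaussian
    ones, determined by the limit of the variances. The vectors [C (r_n h)]
    converge to a vector [S h] which is orthogonal to [H2]. Therefore the
    characteristic function of the pair is a product, [z] is independent of the
    observation ([innovation_independent]), and [z] is Gaussian with covariance
    [S]. Moreover [S] is the short of [C] to [H1] ([short_lim_is_short]): it has
    its range in [H1] and [S <= C], while an operator [X] with these properties
    satisfies [<X h, h> = <X (r_n h), r_n h> <= <C (r_n h), r_n h>], whose limit
    is [<S h, h>].

    The conditional measure at [t] is the law of [z + m + Lam (t - m)]. It is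
    Gaussian with covariance [S] for every [t], not just almost every [t], since
    [t] only enters through a translation; and it is a conditional probability
    by Fubini's theorem for the independent pair ([conditional_measure_rcp]).

    Laws are identified by characteristic functions, and this rests on two
    facts. Trigonometric polynomials form an algebra of bounded functions, from
    which polynomial approximations of the sign function produce the indicator
    functions of a generating family of sets ([trigonometric_unique]). The
    characteristic function of the normal law solves a linear differential
    equation, by Stein's identity ([normal_cos], [normal_sin]). *)

Set Implicit Arguments.
Unset Strict Implicit.
Unset Printing Implicit Defensive.

Local Open Scope classical_set_scope.
Local Open Scope ring_scope.

(** * Real inner products *)

Section inner_theory.
Variables (R : realType) (H : hilbertType R).
Implicit Types x y z : H.

Lemma innerC x y : inner x y = inner y x.
Proof. by rewrite hermC expr0 mul1r. Qed.

Lemma innerDl x y z : inner (x + y) z = inner x z + inner y z.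
Proof. by rewrite linearDl. Qed.

Lemma innerZl (a : R) x z : inner (a *: x) z = a * inner x z.
Proof. by rewrite linearZl_LR. Qed.

Lemma innerNl x z : inner (- x) z = - inner x z.
Proof. by rewrite linearNl. Qed.

Lemma innerBl x y z : inner (x - y) z = inner x z - inner y z.
Proof. by rewrite linearBl. Qed.

Lemma innerDr x y z : inner z (x + y) = inner z x + inner z y.
Proof. by rewrite linearDr. Qed.

Lemma innerZr (a : R) x z : inner z (a *: x) = a * inner z x.
Proof. by rewrite linearZr. Qed.

Lemma innerNr x z : inner z (- x) = - inner z x.
Proof. by rewrite linearNr. Qed.

Lemma innerBr x y z : inner z (x - y) = inner z x - inner z y.
Proof. by rewrite linearBr. Qed.

Lemma inner0r x : inner x 0 = 0.
Proof. by rewrite linear0r. Qed.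

Lemma inner0l x : inner 0 x = 0.
Proof. by rewrite linear0l. Qed.

Lemma inner_sumr x I r (P : pred I) (F : I -> H) :
  inner x (\sum_(i <- r | P i) F i) = \sum_(i <- r | P i) inner x (F i).
Proof. by rewrite linear_sumr. Qed.

Lemma inner_suml x I r (P : pred I) (F : I -> H) :
  inner (\sum_(i <- r | P i) F i) x = \sum_(i <- r | P i) inner (F i) x.
Proof. by rewrite innerC inner_sumr; under eq_bigr do rewrite innerC. Qed.

Lemma inner_inj x y : (forall z, inner x z = inner y z) -> x = y.
Proof.
move=> xy; apply/eqP; rewrite -subr_eq0 -normr_eq0 -sqrf_eq0 -innerxx innerBl.
by rewrite xy subrr.
Qed.

End inner_theory.

(** * Gram-Schmidt orthogonalization for a semidefinite form *)

Section gram_schmidt.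
Variables (R : realType) (V : lmodType R) (b : V -> V -> R).
Hypothesis bC : forall x y, b x y = b y x.
Hypothesis bP : forall a x y z, b (a *: x + y) z = a * b x z + b y z.
Hypothesis b_ge0 : forall x, 0 <= b x x.

Let bPr a x y z : b z (a *: x + y) = a * b z x + b z y.
Proof. by rewrite bC bP ![b _ z]bC. Qed.

Let bD x y z : b (x + y) z = b x z + b y z.
Proof. by rewrite -[x]scale1r bP mul1r scale1r. Qed.

Let b0 z : b 0 z = 0.
Proof. by have := bD 0 0 z; rewrite addr0 -[LHS]addr0 => /addrI/esym. Qed.

Let bZ a x z : b (a *: x) z = a * b x z.
Proof. by rewrite -[a *: x]addr0 bP b0 addr0. Qed.

Let bB x y z : b (x - y) z = b x z - b y z.
Proof. by rewrite bD -scaleN1r bZ mulN1r. Qed.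

Let bZr a x z : b z (a *: x) = a * b z x.
Proof. by rewrite bC bZ bC. Qed.

Let bBr x y z : b z (x - y) = b z x - b z y.
Proof. by rewrite bC bB ![b _ z]bC. Qed.

Lemma semidefinite_CauchySchwarz x y : b x y ^+ 2 <= b x x * b y y.
Proof.
have key t : 0 <= b x x - 2 * t * b x y + t ^+ 2 * b y y.
  have := b_ge0 (x - t *: y).
  rewrite bB !bBr !bZ !bZr [b y x]bC => h.
  by rewrite (le_trans h)// le_eqVlt; apply/orP; left; apply/eqP; ring.
have [y0|y0] := eqVneq (b y y) 0; last first.
  have yp : 0 < b y y by rewrite lt_neqAle eq_sym y0 b_ge0.
  have := key (b x y / b y y).
  rewrite -(ler_pM2r yp) mul0r.
  suff -> : (b x x - 2 * (b x y / b y y) * b x y +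
    (b x y / b y y) ^+ 2 * b y y) * b y y = b x x * b y y - b x y ^+ 2.
    by rewrite subr_ge0.
  by field.
rewrite y0 mulr0; have [->|xy0] := eqVneq (b x y) 0; first by rewrite expr0n.
(* [y] is a null vector: the nonnegative function [key] of [t] is affine, and
   this value of [t] makes it equal to [-1] if its slope is not zero *)
have := key ((b x x + 1) / (2 * b x y)); rewrite y0 mulr0 addr0.
have -> : 2 * ((b x x + 1) / (2 * b x y)) * b x y = b x x + 1 by field.
by rewrite opprD addrA subrr add0r ler0N1.
Qed.

Lemma semidefinite_eq0 x y : b x x = 0 -> b x y = 0.
Proof.
move=> x0; have := semidefinite_CauchySchwarz x y; rewrite x0 mul0r => h.
by apply/eqP; rewrite -sqrf_eq0 eq_le h sqr_ge0.
Qed.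

Variable d : nat -> V.

(** A null vector is sent to [0], because the inverse of [0] is [0]. Every
    vector built by the process below is thus either a unit vector or zero, and
    linearly dependent inputs call for no special treatment. *)
Definition normalize x : V := (Num.sqrt (b x x))^-1 *: x.

(** [gs_res n h] is what remains of [h] after subtracting its projections on
    the first [n] Gram-Schmidt vectors. *)
Fixpoint gs_res n (h : V) : V :=
  if n is n'.+1 then
    gs_res n' h - b (normalize (gs_res n' (d n'))) h *:
                  normalize (gs_res n' (d n'))
  else h.

Definition gs n := normalize (gs_res n (d n)).

Lemma gs_resS n h : gs_res n.+1 h = gs_res n h - b (gs n) h *: gs n.
Proof. by []. Qed.

Lemma gs_resE n h : gs_res n h = h - \sum_(i < n) b (gs i) h *: gs i.
Proof.
elim: n => [|n ih]; first by rewrite big_ord0 subr0.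
by rewrite gs_resS ih big_ord_recr /= opprD addrA.
Qed.

Lemma gs_res_linear n a x y : gs_res n (a *: x + y) = a *: gs_res n x + gs_res n y.
Proof.
elim: n => [|n ih]; first by [].
rewrite !gs_resS ih bPr scalerDl scalerBr.
by rewrite opprD addrACA -scalerA.
Qed.

Let normalize_cases x :
  b (normalize x) (normalize x) = 1 \/ (b x x = 0 /\ normalize x = 0).
Proof.
have [x0|x0] := eqVneq (b x x) 0.
  by right; split => //; rewrite /normalize x0 sqrtr0 invr0 scale0r.
left; rewrite /normalize bZ bC bZ mulrA -expr2 exprVn sqr_sqrtr ?b_ge0//.
by rewrite mulVf.
Qed.

Lemma gs_norm n : b (gs n) (gs n) = 1 \/ gs n = 0.
Proof. by have [|[]] := normalize_cases (gs_res n (d n)); [left|right]. Qed.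

Lemma gs_res_adj n h g : b (gs_res n h) g = b h (gs_res n g).
Proof.
elim: n h g => [|n ih] h g; first by [].
by rewrite !gs_resS bB ih bZ bBr bZr [b h (gs n)]bC mulrC.
Qed.

Lemma gs_res_idem n h g : b (gs_res n h) (gs_res n g) = b (gs_res n h) g.
Proof.
elim: n h g => [|n ih] h g; first by [].
have bk x : b (gs n) (gs_res n x) = b (gs n) x.
  rewrite /gs /normalize !bZ; congr (_ * _).
  exact: ih.
have bk' x : b (gs_res n x) (gs n) = b (gs n) x by rewrite bC bk.
rewrite !gs_resS; move: (gs n) bk bk' (gs_norm n) => k bk bk' kk.
rewrite !bB !bBr !bZ !bZr ih bk bk'.
by case: kk => ->; rewrite ?b0; ring.
Qed.

Let gs_gs_res n x : b (gs n) (gs_res n x) = b (gs n) x.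
Proof. by rewrite /gs /normalize !bZ; congr (_ * _); exact: gs_res_idem. Qed.

Lemma gs_res_sqr n h :
  b (gs_res n h) (gs_res n h) = b h h - \sum_(i < n) b (gs i) h ^+ 2.
Proof.
rewrite gs_res_idem; elim: n => [|n ih]; first by rewrite big_ord0 subr0.
rewrite gs_resS big_ord_recr/=; move: (gs n) => k.
by rewrite bB ih bZ expr2; ring.
Qed.

Lemma gs_Bessel n h : \sum_(i < n) b (gs i) h ^+ 2 <= b h h.
Proof. by rewrite -subr_ge0 -gs_res_sqr b_ge0. Qed.

Let gs_res_sqrS n h :
  b (gs_res n.+1 h) (gs_res n.+1 h) = b (gs_res n h) (gs_res n h) - b (gs n) h ^+ 2.
Proof. by rewrite !gs_res_sqr big_ord_recr/=; ring. Qed.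

Let gs_res_null n m h : (n <= m)%N -> b (gs_res n h) (gs_res n h) = 0 ->
  b (gs_res m h) (gs_res m h) = 0.
Proof.
move=> /subnK <-; elim: (m - n)%N => [|k ih] h0; first by [].
rewrite addSn.
apply/eqP; rewrite eq_le b_ge0 andbT gs_res_sqrS ih// sub0r oppr_le0.
exact: sqr_ge0.
Qed.

(** Step [j] removes the whole of [d_j], up to a null vector, and later steps
    do not bring it back; as the residue map is self-adjoint for [b], the
    residues of any other vector are orthogonal to [d_j] from then on. *)
Lemma gs_res_orth n j h : (j < n)%N -> b (gs_res n h) (d j) = 0.
Proof.
move=> jn; rewrite gs_res_adj bC; apply: semidefinite_eq0.
apply: (gs_res_null jn).
rewrite gs_res_sqrS /gs /normalize bZ gs_res_idem.
set t := b _ _; have t0 : 0 <= t by rewrite /t -gs_res_idem b_ge0.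
have [->|tn] := eqVneq t 0; first by rewrite mulr0 expr0n subrr.
by rewrite exprMn exprVn -/t sqr_sqrtr// expr2 mulrA mulVf// mul1r subrr.
Qed.

Lemma gs_orth i j : i != j -> b (gs i) (gs j) = 0.
Proof.
suff w k l : (k < l)%N -> b (gs k) (gs l) = 0.
  rewrite neq_ltn => /orP[/w//|/w]; by rewrite bC.
move=> kl; suff k0 : b (gs_res l (gs k)) (gs_res l (gs k)) = 0.
  rewrite bC [X in b X _]/gs /normalize bZ; apply/eqP; rewrite mulf_eq0;
    apply/orP; right.
  rewrite gs_res_adj [b (d l) _]bC.
  by rewrite (semidefinite_eq0 _ k0).
apply: (gs_res_null kl); rewrite gs_res_sqrS gs_res_idem bC gs_gs_res.
by have [->|->] := gs_norm k; rewrite ?b0 ?expr1n ?expr0n subrr.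
Qed.

End gram_schmidt.

(** * Norm, Parseval identity, Borel sets of a separable Hilbert space *)

Section hilbert_norm.
Variables (R : realType) (H : hilbertType R).
Implicit Types x y z : H.

Let ip (x y : H) : R := inner x y.
Let ipC x y : ip x y = ip y x. Proof. exact: innerC. Qed.
Let ipP (a : R) x y z : ip (a *: x + y) z = a * ip x z + ip y z.
Proof. by rewrite /ip innerDl innerZl. Qed.
Let ip_ge0 x : 0 <= ip x x. Proof. by rewrite /ip innerxx sqr_ge0. Qed.

Lemma CauchySchwarz x y : `|inner x y| <= `|x| * `|y|.
Proof.
rewrite -(@ler_pXn2r _ 2)// ?nnegrE ?mulr_ge0//.
rewrite exprMn real_normK ?num_real// -!innerxx.
exact: (semidefinite_CauchySchwarz ipC ipP ip_ge0).
Qed.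

Lemma inner_continuous z : continuous (inner z).
Proof.
move=> x; apply/cvgrPdist_le => e e0; near=> y.
rewrite -innerBr (le_trans (CauchySchwarz _ _))//.
have : `|x - y| <= e / (`|z| + 1).
  near: y; apply: cvgr_dist_le; first exact: cvg_id.
  by rewrite divr_gt0// ltr_wpDl.
rewrite ler_pdivlMr ?ltr_wpDl// => h; rewrite (le_trans _ h)// mulrC.
by rewrite ler_wpM2l// lerDl.
Unshelve. all: by end_near. Qed.

Definition dense_seq (S : set H) (d : nat -> H) :=
  (forall n, S (d n)) /\
  (forall x, S x -> forall e : R, 0 < e -> exists n, `|x - d n| < e).

Lemma separable_dense_seq (S : set H) : S 0 -> separable S ->
  exists d, dense_seq S d.
Proof.
move=> S0 [D [/countable_injP[f finj] DS SD]].
pose d n := xget 0 [set x | D x /\ f x = n].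
exists d; split => [n|x Sx e e0].
  by rewrite /d; case: xgetP => // x _ [/DS].
have [y [Dy xy]] := SD _ Sx _ (nbhsx_ballx x e e0).
exists (f y).
have -> : d (f y) = y.
  rewrite /d; case: xgetP => [z _ [Dz fzy]|/(_ y) /=];
    last by move=> /(_ (conj Dy erefl)).
  by apply: finj; rewrite ?inE.
by move: xy; rewrite -ball_normE.
Qed.

Lemma dense_seq_add (S1 S2 : set H) (d1 d2 : nat -> H) :
  dense_seq S1 d1 -> dense_seq S2 d2 ->
  (forall z, exists x y, [/\ S1 x, S2 y & z = x + y]) ->
  exists d, dense_seq setT d.
Proof.
move=> [_ h1] [_ h2] dec.
pose d n := let p := odflt (0%N, 0%N) (unpickle n) in d1 p.1 + d2 p.2.
exists d; split => [//|z _ e e0].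
have [x [y [Sx Sy ->]]] := dec z.
have [i hi] := h1 _ Sx _ (divr_gt0 e0 (ltr0n _ 2)).
have [j hj] := h2 _ Sy _ (divr_gt0 e0 (ltr0n _ 2)).
exists (pickle (i, j)); rewrite /d pickleK/= opprD addrACA.
by rewrite (le_lt_trans (ler_normD _ _))// [e]splitr ltrD.
Qed.

(** Bessel's inequality is an equality in the limit because the [n]-th residue
    kills [d_0], ..., [d_(n-1)] and is a contraction: the residue of [x] is
    that of [x - d_j], hence no longer than [x - d_j]. *)
Lemma Parseval d x : dense_seq setT d ->
  (fun n => \sum_(i < n) inner (gs ip d i) x ^+ 2) @ \oo --> `|x| ^+ 2.
Proof.
move=> [_ dd]; apply/cvgrPdist_le => e e0.
have [j] := dd x I (Num.sqrt e) (ltac:(by rewrite sqrtr_gt0)).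
move=> xj; exists j.+1 => //= n /= jn.
have h0 y : `|y| ^+ 2 - \sum_(i < n) inner (gs ip d i) y ^+ 2 = `|gs_res ip d n y| ^+ 2.
  by rewrite -!innerxx -/(ip _ (gs_res _ _ _ _)) (gs_res_sqr ipC ipP ip_ge0).
rewrite h0 ger0_norm ?sqr_ge0//.
have -> : gs_res ip d n x = gs_res ip d n (x - d j).
  have dj0 : gs_res ip d n (d j) = 0.
    apply/eqP; rewrite -normr_eq0 -sqrf_eq0 -innerxx; apply/eqP.
    have := gs_res_idem ipC ipP ip_ge0 d n (d j) (d j); rewrite /ip => ->.
    exact: (gs_res_orth ipC ipP ip_ge0).
  have := gs_res_linear ipC ipP d n (-1) (d j) x.
  by rewrite dj0 scaler0 add0r scaleN1r addrC => ->.
rewrite -h0 (@le_trans _ _ (`|x - d j| ^+ 2))//.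
  by rewrite gerBl sumr_ge0// => i _; exact: sqr_ge0.
rewrite -[leRHS]sqr_sqrtr ?(ltW e0)//.
by rewrite ler_pXn2r ?nnegrE ?sqrtr_ge0// ltW.
Qed.

Lemma Bessel d n x : \sum_(i < n) inner (gs ip d i) x ^+ 2 <= `|x| ^+ 2.
Proof. by rewrite -innerxx; exact: (gs_Bessel ipC ipP ip_ge0). Qed.

Lemma continuous_borel_measurable (f : H -> R) :
  continuous f -> measurable_fun setT (f : borel H -> R).
Proof.
move=> cf; apply: (measurability (@RGenOInfty.G R)).
  exact: RGenOInfty.measurableE.
move=> _ [_ [a ->] <-]; rewrite setTI.
apply: sub_sigma_algebra; move/continuousP: cf; apply; exact: interval_open.
Qed.

Lemma translation_measurable c :
  measurable_fun setT ((fun x : H => x - c) : borel H -> borel H).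
Proof.
apply: (@measurability _ _ (borel H) (borel H) setT _ (@open H)) => //.
move=> _ [U oU <-]; rewrite setTI; apply: sub_sigma_algebra.
apply: open_comp => // x _.
by apply: cvgB; [exact: cvg_id|exact: cvg_cst].
Qed.

Lemma measurable_inner z : measurable_fun setT (inner z : borel H -> R).
Proof. by apply: continuous_borel_measurable; exact: inner_continuous. Qed.

(** By Parseval's identity the squared distance of [f t] to a point is a
    countable sum of measurable functions of [t], so that preimages of balls are
    measurable; in a separable space every open set is a countable union of
    balls with centers in a dense sequence and radii [1 / k]. *)
Lemma weakly_measurable d (T : measurableType d) (f : T -> H) :
  (exists e, dense_seq setT e) ->
  (forall z, measurable_fun setT (fun t => inner z (f t))) ->
  measurable_fun setT (f : T -> borel H).
Proof.
move=> [e de] mf.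
have mnorm c : measurable_fun setT (fun t => `|f t - c| ^+ 2).
  apply: (measurable_fun_cvg
    (h := fun n t => \sum_(i < n) inner (gs ip e i) (f t - c) ^+ 2)).
  - move=> n; apply: measurable_sum => i; apply: measurable_funX.
    under eq_fun do rewrite innerBr.
    by apply: measurable_funB => //; exact: mf.
  - by move=> t _; exact: Parseval.
apply: (@measurability _ _ T (borel H) setT f (@open H)) => //.
move=> _ [U oU <-]; rewrite setTI.
have -> : f @^-1` U = \bigcup_n \bigcup_k
   (if `[< ball (e n) k.+1%:R^-1 `<=` U >]
    then [set t | `|f t - e n| ^+ 2 < k.+1%:R^-1 ^+ 2] else set0).
  apply/seteqP; split => t /=.
    move=> Uft; have /nbhs_ballP[r /= r0 rU] := open_nbhs_nbhs (conj oU Uft).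
    have [k hk] : exists k, k.+1%:R^-1 < r / 2.
      have [k _ /(_ k (leqnn k)) hk] :=
        near_infty_natSinv_lt (PosNum (divr_gt0 r0 (ltr0n R 2))).
      by exists k.
    have [n hn] := de.2 (f t) I k.+1%:R^-1 (ltac:(by rewrite invr_gt0)).
    exists n => //; exists k => //.
    case: asboolP => [_ /=|[y]].
      by rewrite ltr_pXn2r ?nnegrE ?invr_ge0.
    rewrite -ball_normE /= => hy; apply: rU; rewrite -ball_normE /=.
    rewrite -(subrKA (e n)) (le_lt_trans (ler_normD _ _))//.
    by rewrite [r]splitr ltrD// ?(lt_trans hn)// (lt_trans hy).
  move=> [n _ [k _]]; case: asboolP => //= bU;
    rewrite ltr_pXn2r ?nnegrE ?invr_ge0//.
  by move=> h; apply: bU; rewrite -ball_normE /= distrC.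
apply: bigcupT_measurable => n; apply: bigcupT_measurable => k.
case: ifP => // _.
have -> : [set t | `|f t - e n| ^+ 2 < k.+1%:R^-1 ^+ 2] =
    setT `&` (fun t => `|f t - e n| ^+ 2) @^-1` `]-oo, k.+1%:R^-1 ^+ 2[%classic.
  by apply/seteqP; split => t /=; rewrite in_itv/=; [split|case].
by apply: mnorm => //; exact: measurable_itv.
Qed.

End hilbert_norm.

(** * Moments and characteristic function of the normal law *)

Lemma measurable_cos (R : realType) : measurable_fun setT (@cos R).
Proof. by apply: continuous_measurable_fun; exact: continuous_cos. Qed.

Lemma measurable_sin (R : realType) : measurable_fun setT (@sin R).
Proof. by apply: continuous_measurable_fun; exact: continuous_sin. Qed.

Lemma sqr_expRN (R : realType) (w : R) : 0 <= w -> w ^+ 2 * expR (- w) <= 4.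
Proof.
move=> w0; rewrite expRN ler_pdivrMr ?expR_gt0//.
have -> : w = 2 * (w / 2) by field.
have h := expR_ge1Dx (w / 2); rewrite [X in _ <= _ * X]expRM_natl.
have h2 : (w / 2) ^+ 2 <= expR (w / 2) ^+ 2.
  by apply: lerXn2r; rewrite ?nnegrE ?expR_ge0//; lra.
by rewrite exprMn; lra.
Qed.

Section normal_density.
Variables (R : realType) (m s : R).
Hypothesis s_neq0 : s != 0.
Let mu := @lebesgue_measure R.
Let g := @normal_pdf R m s.
Implicit Types f : R -> R.

Let mg : measurable_fun setT g. Proof. exact: measurable_normal_pdf. Qed.

Lemma ge0_integral_normal_prob (f : R -> \bar R) : measurable_fun setT f ->
  (forall x, 0 <= f x)%E ->
  (\int[normal_prob m s]_x f x = \int[mu]_x (f x * (g x)%:E))%E.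
Proof.
move=> mf f0.
have dom : normal_prob m s `<< mu by exact: normal_prob_dominates.
rewrite -(Radon_Nikodym_SigmaFinite.change_of_variables dom)//.
apply: ae_eq_integral => //.
- apply: emeasurable_funM => //; apply: measurable_int.
  exact: (Radon_Nikodym_SigmaFinite.f_integrable dom).
- by apply: emeasurable_funM => //; exact/measurable_EFinP.
- apply: ae_eqe_mul2l; apply: integral_ae_eq => //.
  + exact: (Radon_Nikodym_SigmaFinite.f_integrable dom).
  + exact/measurable_EFinP.
  + by move=> E _ mE; rewrite -Radon_Nikodym_SigmaFinite.f_integral.
Qed.

Lemma integrable_normal_prob f : measurable_fun setT f ->
  mu.-integrable setT (fun x => (f x * g x)%:E) ->
  (normal_prob m s).-integrable setT (EFin \o f).
Proof.
move=> mf /integrableP[_ fg]; apply/integrableP; split;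
  first exact/measurable_EFinP.
rewrite ge0_integral_normal_prob//; last first.
  by apply: measurableT_comp => //; exact/measurable_EFinP.
under eq_integral => x _ do rewrite /= -EFinM -{1}[g x]ger0_norm ?normal_pdf_ge0// -normrM.
exact: fg.
Qed.

Lemma integral_normal_prob f : measurable_fun setT f ->
  (normal_prob m s).-integrable setT (EFin \o f) ->
  (\int[normal_prob m s]_x (f x)%:E = \int[mu]_x (f x * g x)%:E)%E.
Proof.
move=> mf intf; rewrite integralE [RHS]integralE; congr (_ - _)%E.
  rewrite ge0_integral_normal_prob//;
    last exact/measurable_funepos/measurable_EFinP.
  apply: eq_integral => x _; rewrite !funeposE EFinM.
  by rewrite -[in RHS](mul0e (g x)%:E) -maxe_pMl ?lee_fin ?normal_pdf_ge0.
rewrite ge0_integral_normal_prob//; last exact/measurable_funeneg/measurable_EFinP.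
apply: eq_integral => x _; rewrite !funenegE EFinM -mulNe.
by rewrite -[in RHS](mul0e (g x)%:E) -maxe_pMl ?lee_fin ?normal_pdf_ge0.
Qed.

Let E x := normal_fun m (2 * s) x.

Let gE x : g x = normal_peak s * E x ^+ 4.
Proof.
rewrite /g normal_pdfE// /E /normal_fun -expRM_natl; congr (_ * expR _).
by field.
Qed.

(** Four copies of [E] make up the density: three of them absorb a polynomial
    of degree four, by [w ^+ 2 * expR (- w) <= 4], and the last one remains
    integrable. *)
Let growth x : (1 + (x - m) ^+ 4) * E x ^+ 4 <= (1 + 256 * s ^+ 4) * E x.
Proof.
have E0 : 0 < E x by exact: expR_gt0.
set w := (x - m) ^+ 2 / (8 * s ^+ 2).
have w0 : 0 <= w by apply: divr_ge0;
  [exact: sqr_ge0|apply: mulr_ge0 => //; exact: sqr_ge0].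
have Ew : E x = expR (- w).
  by rewrite /E /normal_fun; congr expR; rewrite /w; field.
have E1 : E x <= 1 by rewrite Ew -[leRHS]expR0 ler_expR oppr_le0.
have -> : (x - m) ^+ 4 = 64 * s ^+ 4 * w ^+ 2 by rewrite /w; field.
have wE : w ^+ 2 * E x <= 4.
  by rewrite Ew; exact: sqr_expRN.
have E3 : E x ^+ 3 <= 1 by rewrite exprn_ile1// ltW.
have s4 : 0 <= s ^+ 4 by exact: exprn_even_ge0.
have -> : (1 + 64 * s ^+ 4 * w ^+ 2) * E x ^+ 4 =
  (E x ^+ 3 + 64 * s ^+ 4 * (w ^+ 2 * E x) * E x ^+ 2) * E x by ring.
rewrite ler_wpM2r ?(ltW E0)// lerD//.
have E2 : E x ^+ 2 <= 1 by rewrite exprn_ile1// ltW.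
have -> : 256 * s ^+ 4 = 64 * s ^+ 4 * 4 * 1 by ring.
have wE0 : 0 <= w ^+ 2 * E x by apply: mulr_ge0; [exact: sqr_ge0|exact: ltW].
have s64 : 0 <= 64 * s ^+ 4 by apply: mulr_ge0.
apply: ler_pM => //; first exact: mulr_ge0; first exact: sqr_ge0.
exact: ler_wpM2l.
Qed.

Let intE : mu.-integrable setT (EFin \o E).
Proof.
have s2 : 2 * s != 0 by rewrite mulf_neq0.
have := integrable_normal_pdf m (2 * s).
move=> /(integrableZl measurableT (normal_peak (2 * s))^-1).
apply: eq_integrable => // x _; rewrite -EFinM normal_pdfE//= mulrA mulVf ?mul1r//.
by rewrite gt_eqF// normal_peak_gt0.
Qed.

Definition quartic_growth f :=
  exists A : R, forall x : R, `|f x| <= A * (1 + (x - m) ^+ 4).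

Lemma quartic_growth_integrable_pdf f : measurable_fun setT f ->
  quartic_growth f -> mu.-integrable setT (fun x => (f x * g x)%:E).
Proof.
move=> mf [A fA].
apply: (le_integrable measurableT _ _
  (integrableZl measurableT (A * normal_peak s * (1 + 256 * s ^+ 4)) intE)).
  by apply/measurable_EFinP; exact: measurable_funM.
have A0 : 0 <= A.
  have := fA m; rewrite subrr expr0n addr0 mulr1; exact: le_trans.
move=> x _; rewrite /= lee_fin normrM [`|g x|]ger0_norm ?normal_pdf_ge0//.
rewrite (le_trans _ (ler_norm _))//.
have g0 : 0 <= g x by exact: normal_pdf_ge0.
rewrite (le_trans (ler_wpM2r g0 (fA x)))//.
rewrite gE -!mulrA ler_wpM2l// mulrCA ler_wpM2l ?normal_peak_ge0//;
  exact: growth.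
Qed.

Lemma quartic_growth_integrable f : measurable_fun setT f ->
  quartic_growth f -> (normal_prob m s).-integrable setT (EFin \o f).
Proof.
by move=> mf fA; apply: integrable_normal_prob => //;
  exact: quartic_growth_integrable_pdf.
Qed.

Let is_derive_g (x : R) : is_derive x 1 g (- ((x - m) / s ^+ 2) * g x).
Proof.
rewrite /g normal_pdfE// /normal_fun.
apply: is_derive_eq.
rewrite /GRing.scale /=.
by field.
Qed.

Let vanish f A : (forall x, `|f x| <= A * (1 + (x - m) ^+ 4)) ->
  exists B, forall x, x - m != 0 -> `|f x * g x| <= B / (x - m) ^+ 2.
Proof.
move=> fA; exists (A * normal_peak s * (1 + 256 * s ^+ 4) * (8 * s ^+ 2)) =>
  x x0.
have A0 : 0 <= A.
  have := fA m; rewrite subrr expr0n addr0 mulr1; exact: le_trans.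
have g0 : 0 <= g x by exact: normal_pdf_ge0.
rewrite normrM [`|g x|]ger0_norm// (le_trans (ler_wpM2r g0 (fA x)))//.
rewrite gE -!mulrA ler_wpM2l// mulrCA ler_wpM2l ?normal_peak_ge0//.
rewrite (le_trans (growth x))// ler_wpM2l//.
  by rewrite addr_ge0// mulr_ge0// exprn_even_ge0.
have x2 : 0 < (x - m) ^+ 2 by rewrite exprn_even_gt0.
have s2 : 0 < s ^+ 2 by rewrite exprn_even_gt0.
rewrite [leRHS](_ : _ = 8 * s ^+ 2 / (x - m) ^+ 2); last by ring.
rewrite ler_pdivlMr// /E /normal_fun mulNr expRN ler_pdivrMl ?expR_gt0//.
have h := expR_ge1Dx ((x - m) ^+ 2 / ((2 * s) ^+ 2 *+ 2)).
have -> : (x - m) ^+ 2 = ((x - m) ^+ 2 / ((2 * s) ^+ 2 *+ 2)) * (8 * s ^+ 2).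
  by field.
apply: ler_wpM2r; first by rewrite mulr_ge0// ltW.
rewrite -(_ : (x - m) ^+ 2 = (x - m) ^+ 2 / ((2 * s) ^+ 2 *+ 2) * (8 * s ^+ 2)).
  by rewrite (le_trans _ h)// lerDr.
by field.
Qed.

(** Integration by parts against the density, whose logarithmic derivative is
    [- (x - m) / s ^+ 2]. The moments follow by taking powers of [x - m] for
    [f], and the characteristic function by taking cosines and sines. *)
Lemma Stein f f' : (forall x : R, is_derive x 1 f (f' x)) -> continuous f' ->
  quartic_growth f -> quartic_growth f' ->
  quartic_growth (fun x => (x - m) * f x) ->
  (\int[normal_prob m s]_x ((x - m) * f x)%:E =
   (s ^+ 2)%:E * \int[normal_prob m s]_x (f' x)%:E)%E.
Proof.
move=> df cf' gf gf' gxf.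
have cf : continuous f by move=> x; apply: differentiable_continuous;
  exact/derivable1_diffP.
have mf : measurable_fun setT f by exact: continuous_measurable_fun.
have mf' : measurable_fun setT f' by exact: continuous_measurable_fun.
have mxf : measurable_fun setT (fun x : R => (x - m) * f x).
  by apply: measurable_funM => //; exact: measurable_funB.
pose F x := f x * g x.
pose k x := f' x * g x - s ^- 2 * ((x - m) * f x * g x).
have dF (x : R) : is_derive x 1 F (k x).
  rewrite /F; have ? := df x; have ? := is_derive_g x.
  apply: is_derive_eq; rewrite /k /GRing.scale /=; field; exact: s_neq0.
have ck : continuous k.
  move=> x; rewrite /k.
  have cg := @continuous_normal_pdf R m s s_neq0 x.
  apply: cvgB; first by apply: cvgM => //; exact: cf'.
  apply: cvgM; first exact: cvg_cst.
  apply: cvgM => //; apply: cvgM; last exact: cf.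
  by apply: cvgB; [exact: cvg_id|exact: cvg_cst].
have i1 := quartic_growth_integrable_pdf mf' gf'.
have i2 := quartic_growth_integrable_pdf mxf gxf.
have i2' := integrableZl measurableT (s ^- 2) i2.
have ik : mu.-integrable setT (EFin \o k).
  apply: eq_integrable (integrableB measurableT i1 i2') => // x _.
have k0 : (\int[mu]_x (k x)%:E = 0)%E.
  (* [k] is the derivative of [F], which vanishes at infinity *)
  pose I n := `[m - n.+1%:R, m + n.+1%:R]%classic.
  have cv : (fun n => \int[mu]_(x in I n) (k x)%:E)%E @ \oo -->
    (\int[mu]_x (k x)%:E)%E.
    under eq_fun do rewrite integral_mkcond.
    apply: (@dominated_cvg _ _ _ mu setT measurableT
      (fun n => (EFin \o k) \_ (I n)) _ (fun x => `|k x|%:E)) => //.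
    - move=> n; apply/(measurable_restrictT _ _).1 => //;
        first exact: measurable_itv.
      by apply: measurable_funTS; apply/measurable_EFinP;
        exact: continuous_measurable_fun.
    - move=> x _; apply: cvg_near_cst.
      near=> n; rewrite patchE ifT// inE /I /= in_itv/=.
      have : `|x - m| <= n.+1%:R.
        near: n; exists (Num.bound `|x - m|) => // n /= hn.
        rewrite (le_trans (ltW (archi_boundP (normr_ge0 _))))// ler_nat.
        exact: leq_trans hn _.
      by rewrite ler_norml => /andP[? ?]; apply/andP; split; lra.
    - exact: integrable_norm ik.
    - move=> n x _; rewrite patchE; case: ifP => _ //=.
      by rewrite normr0 lee_fin.
  have FTC n : (\int[mu]_(x in I n) (k x)%:E = (F (m + n.+1%:R) - F (m - n.+1%:R))%:E)%E.
    rewrite EFinB; apply: continuous_FTC2.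
    + by rewrite ltrD2l gtrN.
    + exact: continuous_subspaceT.
    + have cF : continuous F by move=> x; apply: differentiable_continuous;
        exact/derivable1_diffP.
      split => //.
      * by apply: cvg_at_right_filter; exact: cF.
      * by apply: cvg_at_left_filter; exact: cF.
    + by move=> x _; rewrite derive1E; exact: derive_val.
  have [A fA] := gf.
  have [B FB] := vanish fA.
  have F0 : (fun n => F (m + n.+1%:R) - F (m - n.+1%:R)) @ \oo --> 0.
    apply: norm_cvg0; apply: (@squeeze_cvgr _ _ _ _ (fun=> 0)
      (fun n => 2 * B * (harmonic n * harmonic n))).
    - apply: nearW => n; rewrite normr_ge0/= (le_trans (ler_normB _ _))//.
      have t0 : n.+1%:R != 0 :> R by [].
      have := FB (m + n.+1%:R); have := FB (m - n.+1%:R).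
      rewrite [m - _]addrC [m + n.+1%:R]addrC !addrK sqrrN oppr_eq0.
      rewrite ![_ + m]addrC => /(_ t0) h1 /(_ t0) h2.
      rewrite (le_trans (lerD h2 h1))// le_eqVlt; apply/orP; left; apply/eqP.
      by rewrite /harmonic/= -invfM -expr2; ring.
    - exact: cvg_cst.
    - rewrite -(mulr0 (2 * B)); apply: cvgMr; rewrite -(mulr0 0).
      by apply: cvgM; exact: cvg_harmonic.
  move: cv; under eq_fun do rewrite FTC.
  by move=> cv; apply: (cvg_unique _ cv) => //; by apply: cvg_EFin F0;
    exact: nearW.
rewrite !integral_normal_prob//; last 2 first.
- exact: quartic_growth_integrable.
- exact: quartic_growth_integrable.
have : (\int[mu]_x ((f' x * g x)%:E - (s ^- 2)%:E * ((x - m) * f x * g x)%:E) = 0)%E.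
  by rewrite -[RHS]k0; apply: eq_integral => x _; rewrite /k EFinB EFinM.
rewrite integralB// integralZl//.
have /fineK <- := integrable_fin_num measurableT i1.
have /fineK <- := integrable_fin_num measurableT i2.
rewrite -!EFinM -EFinB => -[] /subr0_eq ->; congr EFin.
by rewrite mulrA divff ?mul1r// expf_neq0.
Unshelve. all: by end_near. Qed.

End normal_density.

Section normal_moments.
Variables (R : realType) (m s : R).
Hypothesis s_neq0 : s != 0.
Let P := normal_prob m s.

Let pow_growth (y : R) k : (k <= 4)%N -> `|y ^+ k| <= 1 + y ^+ 4.
Proof.
move=> k4; rewrite -[y ^+ 4]ger0_norm ?exprn_even_ge0// !normrX.
have [y1|/ltW y1] := leP `|y| 1.
  by rewrite (le_trans (exprn_ile1 k (normr_ge0 _) y1))// lerDl exprn_ge0.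
by rewrite (le_trans (ler_weXn2l _ k4))// lerDr.
Qed.

Let bounded_growth (f : R -> R) (A : R) : (forall x, `|f x| <= A) ->
  quartic_growth m f.
Proof.
move=> fA; exists A => x; rewrite (le_trans (fA x))// -[leLHS]mulr1.
rewrite ler_wpM2l ?lerDl ?exprn_even_ge0//; exact: le_trans (fA 0).
Qed.

Let linear_growth (f : R -> R) (A : R) : (forall x, `|f x| <= A) ->
  quartic_growth m (fun x => (x - m) * f x).
Proof.
move=> fA; exists A => x; rewrite normrM mulrC.
by rewrite ler_pM// -[x - m]expr1; exact: pow_growth.
Qed.

Let pow_quartic k : (k <= 4)%N -> quartic_growth m (fun x => (x - m) ^+ k).
Proof. by move=> k4; exists 1 => x; rewrite mul1r; exact: pow_growth. Qed.

Let mpow k : measurable_fun setT (fun x : R => (x - m) ^+ k).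
Proof. by apply: measurable_funX => //; exact: measurable_funB. Qed.

Let continuous_center : continuous (fun x : R => x - m).
Proof. by move=> x; apply: cvgB; [exact: cvg_id|exact: cvg_cst]. Qed.

Lemma normal_integrable_pow k : (k <= 4)%N ->
  P.-integrable setT (fun x => ((x - m) ^+ k)%:E).
Proof.
move=> k4; apply: (quartic_growth_integrable s_neq0 (mpow k)).
exact: pow_quartic.
Qed.

Lemma normal_moment1 : (\int[P]_x (x - m)%:E = 0)%E.
Proof.
have := @Stein R m s s_neq0 (fun=> 1) (fun=> 0).
rewrite integral_cst//= mul0e mule0; under eq_integral do rewrite mulr1; apply.
- by move=> x; exact: cvg_cst.
- by apply: (@bounded_growth _ 1) => x; rewrite normr1.
- by apply: (@bounded_growth _ 0) => x; rewrite normr0.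
- by apply: (@linear_growth _ 1) => x; rewrite normr1.
Qed.

Lemma normal_moment2 : (\int[P]_x ((x - m) ^+ 2)%:E = (s ^+ 2)%:E)%E.
Proof.
have := @Stein R m s s_neq0 (fun x => x - m) (fun=> 1).
rewrite integral_cst//= mul1e probability_setT mule1.
under eq_integral do rewrite -expr2; apply.
- by move=> x; apply: is_derive_eq; rewrite subr0.
- by move=> x; exact: cvg_cst.
- exact: (@pow_quartic 1).
- by apply: (@bounded_growth _ 1) => x; rewrite normr1.
- exact: (@pow_quartic 2).
Qed.

Lemma normal_moment4 : (\int[P]_x ((x - m) ^+ 4)%:E = (3 * s ^+ 4)%:E)%E.
Proof.
have St : (\int[P]_x ((x - m) * (x - m) ^+ 3)%:E =
    (s ^+ 2)%:E * \int[P]_x (3 * (x - m) ^+ 2)%:E)%E.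
  apply: (Stein s_neq0).
  - by move=> x; apply: is_derive_eq; rewrite /GRing.scale/=; ring.
  - move=> x; apply: cvgM; first exact: cvg_cst.
    by apply: cvgM; exact: continuous_center.
  - exact: (@pow_quartic 3).
  - have [A hA] := @pow_quartic 2 isT; exists (3 * A) => x.
    by rewrite normrM ger0_norm// -mulrA ler_wpM2l.
  - exact: (@pow_quartic 4).
under eq_integral do rewrite exprS.
rewrite St; under eq_integral do rewrite EFinM.
rewrite integralZl//; last exact: normal_integrable_pow.
by rewrite normal_moment2 -!EFinM; congr EFin; ring.
Qed.

(** Stein's identity turns the derivative in [t] of the expectation [phi t] of
    [c (t (x - m))] into [- s ^+ 2 * t * phi t], a differential equation that
    determines [phi] from its value at [0]. The parameter [sg] is the sign that
    distinguishes the pair cosine, sine from the pair sine, cosine. *)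
Let ODE (c c' : R -> R) (sg : R) :
  (forall x : R, is_derive x 1 c (sg * c' x)) ->
  (forall x : R, is_derive x 1 c' (- sg * c x)) ->
  (forall x, `|c x| <= 1) -> (forall x, `|c' x| <= 1) -> `|sg| = 1 ->
  forall t : R, (\int[P]_x c (t * (x - m))) = c 0 * expR (- (t ^+ 2 * s ^+ 2 / 2)).
Proof.
move=> dc dc' c1 c'1 sg1.
have cc : continuous c by move=> x; apply: differentiable_continuous;
  exact/derivable1_diffP.
have cc' : continuous c' by move=> x; apply: differentiable_continuous;
  exact/derivable1_diffP.
have ccm t : continuous (fun x => c (t * (x - m))).
  move=> x; apply: continuous_comp; last exact: cc.
  by apply: cvgM; [exact: cvg_cst|exact: continuous_center].
have cc'm t : continuous (fun x => c' (t * (x - m))).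
  move=> x; apply: continuous_comp; last exact: cc'.
  by apply: cvgM; [exact: cvg_cst|exact: continuous_center].
have ic t : P.-integrable setT (fun x => (c (t * (x - m)))%:E).
  apply: (quartic_growth_integrable s_neq0);
    first exact: continuous_measurable_fun.
  exact: (@bounded_growth _ 1).
pose phi (t : R) := (\int[P]_x c (t * (x - m))).
have dphi (t : R) : is_derive t 1 phi (- s ^+ 2 * t * phi t).
  have df (u : R) x : is_derive u 1 (fun v : R => c (v * (x - m)))
    (sg * c' (u * (x - m)) * (x - m)).
    have ? := dc (u * (x - m)).
    apply: is_derive_eq; rewrite /GRing.scale/=; ring.
  have It : `]t - 1, t + 1[%classic t by rewrite /= in_itv/=; apply/andP; split;
    lra.
  have Gi : P.-integrable setT (EFin \o (fun x => `|x - m|)).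
    by apply: integrable_norm; exact: (@normal_integrable_pow 1).
  have Gb (u x : R) : `]t - 1, t + 1[%classic u -> setT x ->
      `|partial1of2 (fun u x => c (u * (x - m))) u x| <= `|x - m|.
    move=> _ _; rewrite partial1of2E derive_val !normrM sg1 mul1r.
    by rewrite ler_piMl.
  have G0 (x : R) : 0 <= `|x - m| by [].
  have der1 (u x : R) : `]t - 1, t + 1[%classic u -> setT x ->
      derivable (fun v : R => c (v * (x - m))) u 1 by move=> _ _;
        exact: ex_derive.
  have D := @derivable_under_integral R _ _ P (fun u x => c (u * (x - m))) setT
    measurableT t _ _ It (fun u _ => ic u) der1 _ G0 Gi Gb.
  have E := @differentiation_under_integral R _ _ P (fun u x => c (u * (x - m))) setT
    measurableT t _ _ It (fun u _ => ic u) der1 _ G0 Gi Gb.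
  apply: DeriveDef; first exact: D.
  rewrite -derive1E E.
  have iS : P.-integrable setT (fun x => ((x - m) * c' (t * (x - m)))%:E).
    apply: (quartic_growth_integrable s_neq0); last exact: (@linear_growth _ 1).
    by apply: measurable_funM; [exact: (mpow 1)|exact: continuous_measurable_fun].
  have SE : (\int[P]_x ((x - m) * c' (t * (x - m)))%:E =
      (s ^+ 2)%:E * ((t * - sg)%:E * \int[P]_x (c (t * (x - m)))%:E))%E.
    rewrite -integralZl//; under [in RHS]eq_integral do rewrite -EFinM -mulrA.
    apply: (Stein s_neq0).
    - move=> x; have ? := dc' (t * (x - m)).
      by apply: is_derive_eq; rewrite /GRing.scale/=; ring.
    - move=> x; apply: cvgM; first exact: cvg_cst.
      by apply: cvgM; [exact: cvg_cst|exact: ccm].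
    - exact: (@bounded_growth _ 1).
    - apply: (@bounded_growth _ `|t|) => x.
      by rewrite !normrM normrN sg1 mul1r ler_piMr.
    - exact: (@linear_growth _ 1).
  have {}SE : \int[P]_x ((x - m) * c' (t * (x - m))) = s ^+ 2 * (t * - sg * phi t).
    rewrite /phi /Rintegral SE.
    by have /fineK <- := integrable_fin_num measurableT (ic t).
  under eq_Rintegral do rewrite partial1of2E derive_val -mulrA [_ * (_ - m)]mulrC.
  rewrite RintegralZl// SE.
  have sg2 : sg * sg = 1 by rewrite -expr2 -[LHS]real_normK ?num_real// sg1 expr1n.
  rewrite (_ : sg * _ = - (sg * sg) * s ^+ 2 * t * phi t); last by ring.
  by rewrite sg2 mulN1r.
pose psi t := phi t * expR (t ^+ 2 * s ^+ 2 / 2).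
have psi' (t : R) : is_derive t 1 psi 0.
  have ? := dphi t.
  apply: is_derive_eq; rewrite /GRing.scale/=.
  by field.
move=> t; have := is_derive_0_is_cst t 0 psi'.
rewrite /psi expr0n/= mul0r mul0r expR0 mulr1 => h.
rewrite -/(phi t) expRN; apply: (canRL (mulfK _));
  first by rewrite gt_eqF ?expR_gt0.
rewrite h /phi; under eq_Rintegral do rewrite mul0r.
rewrite Rintegral_cst// [X in fine X](_ : _ = 1%E);
  last exact: probability_setT.
by rewrite mulr1.
Qed.

Lemma normal_cos (t : R) :
  \int[P]_x cos (t * (x - m)) = expR (- (t ^+ 2 * s ^+ 2 / 2)).
Proof.
transitivity (cos 0 * expR (- (t ^+ 2 * s ^+ 2 / 2)));
  last by rewrite cos0 mul1r.
apply: (@ODE cos sin (-1)).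
- by move=> x; rewrite mulN1r; exact: is_derive_cos.
- by move=> x; rewrite opprK mul1r; exact: is_derive_sin.
- exact: cos_max.
- exact: sin_max.
- by rewrite normrN1.
Qed.

Lemma normal_sin (t : R) : \int[P]_x sin (t * (x - m)) = 0.
Proof.
transitivity (sin 0 * expR (- (t ^+ 2 * s ^+ 2 / 2)));
  last by rewrite sin0 mul0r.
apply: (@ODE sin cos 1).
- by move=> x; rewrite mul1r; exact: is_derive_sin.
- by move=> x; rewrite mulN1r; exact: is_derive_cos.
- exact: sin_max.
- exact: cos_max.
- by rewrite normr1.
Qed.

End normal_moments.

(** * Measures determined by an algebra of bounded functions *)

Section sign_polynomials.
Variable R : realType.
Implicit Types y : R.

(** The iterates of this odd polynomial converge on [[-1, 1]] to the sign
    function, whose values [-1], [0], [1] are its fixed points. The points [-1]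
    and [1] are attracting: starting from [y > 0], each step multiplies the
    distance to [1] by at most [1 - y / 2]. *)
Definition smooth_sign y : R := y * (3 - y ^+ 2) / 2.

Let sign_step y z : 0 < y -> y <= z -> z <= 1 ->
  [/\ y <= smooth_sign z, smooth_sign z <= 1 &
      1 - smooth_sign z <= (1 - z) * (1 - y / 2)].
Proof.
move=> y0 yz z1; have z0 : 0 < z by exact: lt_le_trans yz.
have e1 : smooth_sign z - z = z * (1 - z ^+ 2) / 2 by rewrite /smooth_sign;
  field.
have e2 : 1 - smooth_sign z = (1 - z) * ((2 - z - z ^+ 2) / 2).
  by rewrite /smooth_sign; field.
have z2 : z ^+ 2 <= 1 by rewrite exprn_ile1// ltW.
have z20 := sqr_ge0 z.
split.
- rewrite (le_trans yz)// -subr_ge0 e1 divr_ge0// mulr_ge0 ?(ltW z0)//; lra.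
- rewrite -subr_ge0 e2 mulr_ge0 ?subr_ge0//; lra.
- rewrite e2 ler_wpM2l ?subr_ge0//; lra.
Qed.

Let iter_pos y n : 0 < y -> y <= 1 ->
  [/\ y <= iter n smooth_sign y, iter n smooth_sign y <= 1 &
      1 - iter n smooth_sign y <= (1 - y / 2) ^+ n].
Proof.
move=> y0 y1; elim: n => [|n [h1 h2 h3]]; first by rewrite /= expr0;
  split => //; lra.
have [g1 g2 g3] := sign_step y0 h1 h2.
rewrite iterS; split => //; rewrite (le_trans g3)// exprSr ler_wpM2r//; lra.
Qed.

Let iterN n y : iter n smooth_sign (- y) = - iter n smooth_sign y.
Proof.
elim: n => [//|n ih]; rewrite !iterS ih /smooth_sign sqrrN; by rewrite !mulNr.
Qed.

Let iter0 n : iter n smooth_sign 0 = 0.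
Proof. by elim: n => [//|n ih]; rewrite iterS ih /smooth_sign mul0r mul0r. Qed.

(** If [u] is a sign, then [(u + u ^+ 2) / 2] is [1] when [u = 1] and [0]
    otherwise. *)
Definition pos_approx n y : R :=
  (iter n smooth_sign y + iter n smooth_sign y ^+ 2) / 2.

Let iter_bnd n y : `|y| <= 1 -> `|iter n smooth_sign y| <= 1.
Proof.
move=> y1; have [y0|y0|<-] := ltgtP 0 y; last by rewrite iter0 normr0.
  move: y1; rewrite gtr0_norm// => y1; have [h1 h2 _] := iter_pos n y0 y1.
  by rewrite ger0_norm// (le_trans _ h1)// ltW.
move: y1; rewrite ltr0_norm// => y1.
have y0' : 0 < - y by rewrite oppr_gt0.
have [h1 h2 _] := iter_pos n y0' y1.
by rewrite -normrN -iterN ger0_norm// (le_trans _ h1)// ltW.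
Qed.

Lemma pos_approx_bnd n y : `|y| <= 1 -> `|pos_approx n y| <= 1.
Proof.
move=> /(iter_bnd n); rewrite /pos_approx; set u := iter _ _ _ => u1.
rewrite normrM [`|2^-1|]ger0_norm// ler_pdivrMr// mul1r.
rewrite (le_trans (ler_normD _ _))// normrX.
by have : `|u| ^+ 2 <= 1 by [rewrite exprn_ile1]; lra.
Qed.

Let iter_cvg y : 0 < y -> y <= 1 -> iter n smooth_sign y @[n --> \oo] -->
  (1 : R).
Proof.
move=> y0 y1; apply/subr_cvg0; apply: norm_cvg0.
apply: (@squeeze_cvgr _ _ _ _ (fun=> 0) (fun n => (1 - y / 2) ^+ n)).
- apply: nearW => n; have [_ h2 h3] := iter_pos n y0 y1.
  by rewrite normr_ge0/= distrC ger0_norm// subr_ge0.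
- exact: cvg_cst.
- by apply: cvg_expr; rewrite ger0_norm; lra.
Qed.

Lemma pos_approx_cvg y : `|y| <= 1 ->
  pos_approx n y @[n --> \oo] --> (if 0 < y then 1 else 0 : R).
Proof.
move=> y1; rewrite /pos_approx; have [y0|y0|<-] := ltgtP 0 y.
- rewrite gtr0_norm// in y1.
  have h := iter_cvg y0 y1.
  rewrite [X in _ --> X](_ : _ = (1 + 1 ^+ 2) / 2 :> R); last by field.
  apply: cvgM; last exact: cvg_cst.
  by apply: cvgD => //; apply: cvgM.
- rewrite ltr0_norm// in y1; have y0' : 0 < - y by rewrite oppr_gt0.
  have h := iter_cvg y0' y1.
  have {}h : iter n smooth_sign y @[n --> \oo] --> (-1 : R).
    rewrite -[y]opprK; under eq_fun do rewrite iterN.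
    exact: cvgN.
  rewrite [X in _ --> X](_ : _ = (-1 + (-1) ^+ 2) / 2 :> R); last by field.
  apply: cvgM; last exact: cvg_cst.
  by apply: cvgD => //; apply: cvgM.
- under eq_fun do rewrite iter0 expr0n addr0 mul0r.
  exact: cvg_cst.
Qed.

End sign_polynomials.

Section algebra_unique.
Context d (T : measurableType d) (R : realType).
Variables (P Q : probability T R) (AA : set (T -> R)).
Hypothesis AA_measurable : forall f, AA f -> measurable_fun setT f.
Hypothesis AA_bounded : forall f, AA f -> exists M, forall x, `|f x| <= M.
Hypothesis AA1 : AA (fun=> 1).
Hypothesis AAD : forall f g, AA f -> AA g -> AA (fun x => f x + g x).
Hypothesis AAZ : forall a f, AA f -> AA (fun x => a * f x).
Hypothesis AAM : forall f g, AA f -> AA g -> AA (fun x => f x * g x).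
Hypothesis AAPQ : forall f, AA f ->
  (\int[P]_x (f x)%:E = \int[Q]_x (f x)%:E)%E.

(** Bounded pointwise limits suffice for the dominated convergence theorem and
    are preserved by products, that is, by intersections of sets. *)
Definition approximable : set (set T) :=
  [set A | exists f_ : nat -> T -> R, [/\ forall n, AA (f_ n),
     forall n x, `|f_ n x| <= 1 &
     forall x, f_ n x @[n --> \oo] --> (\1_A x : R)]].

Let approximable_measurable A : approximable A -> measurable A.
Proof.
move=> [f_ [fA f1 fc]].
have m1 : measurable_fun setT (\1_A : T -> R).
  by apply: (measurable_fun_cvg (h := f_)) => // n; exact: AA_measurable.
have -> : A = setT `&` (\1_A : T -> R) @^-1` [set 1].
  rewrite setTI; apply/seteqP; split => x /=; rewrite indicE.
    by move=> Ax; rewrite mem_set.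
  by case: (boolP (x \in A)) => [/set_mem//|_ /esym/eqP]; rewrite oner_eq0.
by apply: m1 => //; exact: measurable_set1.
Qed.

Let approximableI : setI_closed approximable.
Proof.
move=> A B [f [fA f1 fc]] [g [gA g1 gc]].
exists (fun n x => f n x * g n x); split => [n|n x|x].
- exact: AAM.
- by rewrite normrM -[1]mulr1 ler_pM.
- by rewrite indicI; exact: cvgM.
Qed.

Let approximable_PQ A : approximable A -> P A = Q A.
Proof.
move=> GA; have mA := approximable_measurable GA.
move: GA => [f_ [fA f1 fc]].
have lim (M : probability T R) :
    (\int[M]_x (f_ n x)%:E)%E @[n --> \oo] --> M A.
  rewrite -[A]setIT -integral_indic//.
  apply: (@dominated_cvg _ _ _ M setT measurableT (fun n x => (f_ n x)%:E) _
    (EFin \o cst 1%R)) => //.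
  - by move=> n; apply/measurable_EFinP; exact: AA_measurable.
  - by move=> x _; apply: cvg_EFin; [exact: nearW|exact: fc].
  - exact: (finite_measure_integrable_cst M 1 measurableT).
  - by move=> n x _ /=; rewrite lee_fin.
have := lim Q; under eq_fun do rewrite -AAPQ//.
by move=> lQ; apply: (cvg_unique _ (lim P) lQ).
Qed.

(** Up to a positive factor [f] has values in [[-1, 1]], where the polynomials
    [pos_approx n] converge to the indicator function of the positive reals. *)
Let approximable_pos f : AA f -> approximable [set x | 0 < f x].
Proof.
move=> Af; have [M fM] := AA_bounded Af.
pose c := (`|M| + 1)^-1.
have M0 : 0 < `|M| + 1 by rewrite ltr_wpDl.
have c0 : 0 < c by rewrite invr_gt0.
have cf x : `|c * f x| <= 1.
  rewrite normrM gtr0_norm// mulrC ler_pdivrMr// mul1r (le_trans (fM x))//.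
  by rewrite (le_trans (ler_norm _))// lerDl.
have Ait n : AA (fun x => iter n (@smooth_sign R) (c * f x)).
  elim: n => [|n ih]; first exact: AAZ.
  have := AAD (AAZ (3 / 2) ih) (AAZ (- 2^-1) (AAM ih (AAM ih ih))).
  congr AA; apply/funext => x; rewrite iterS.
  by rewrite /smooth_sign; field.
exists (fun n x => pos_approx n (c * f x)); split => [n|n x|x].
- have := AAD (AAZ 2^-1 (Ait n)) (AAZ 2^-1 (AAM (Ait n) (Ait n))).
  by congr AA; apply/funext => x; rewrite /pos_approx; field.
- exact: pos_approx_bnd.
- have := pos_approx_cvg (cf x); rewrite pmulr_rgt0// indicE.
  rewrite (_ : (x \in _) = (0 < f x)); last by apply/idP/idP; rewrite inE.
  by case: (0 < f x).
Qed.

Lemma algebra_measurable f : AA f ->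
  measurable_fun setT (f : g_sigma_algebraType approximable -> R).
Proof.
move=> Af; apply: (measurability (@RGenOInfty.G R)).
  exact: RGenOInfty.measurableE.
move=> _ [_ [a ->] <-]; rewrite setTI; apply: sub_sigma_algebra.
have := approximable_pos (AAD Af (AAZ (- a) AA1)).
congr approximable; apply/seteqP; split => x /=; rewrite in_itv/= andbT mulr1.
  by rewrite subr_gt0.
by rewrite subr_gt0.
Qed.

(** The two measures agree on approximable sets by dominated convergence; these
    sets are closed under intersection, whence the conclusion by the monotone
    class theorem. *)
Lemma algebra_unique A : <<s approximable >> A -> P A = Q A.
Proof.
have GT : approximable setT.
  exists (fun _ _ => 1); split => [n|n x|x]; first exact: AA1.
    by rewrite normr1.
  by rewrite indicT; exact: cvg_cst.
apply: (@g_sigma_algebra_measure_unique _ _ _ approximable _ (fun=> setT)) => //.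
- by rewrite bigcup_const.
- by rewrite (le_lt_trans (probability_le1 P measurableT))// ltry.
Qed.

End algebra_unique.

(** * Uniqueness of characteristic functions *)

Section trigonometric_unique.
Context d (T : measurableType d) (R : realType) (V : lmodType R).
Variables (P Q : probability T R) (l : V -> T -> R).
Hypothesis lP : forall a u v x, l (a *: u + v) x = a * l u x + l v x.
Hypothesis ml : forall v, measurable_fun setT (l v).
Hypothesis lcos : forall v,
  (\int[P]_x (cos (l v x))%:E = \int[Q]_x (cos (l v x))%:E)%E.
Hypothesis lsin : forall v,
  (\int[P]_x (sin (l v x))%:E = \int[Q]_x (sin (l v x))%:E)%E.

Inductive trig_poly : (T -> R) -> Prop :=
| trig_cos v : trig_poly (fun x => cos (l v x))
| trig_sin v : trig_poly (fun x => sin (l v x))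
| trig_add f g : trig_poly f -> trig_poly g -> trig_poly (fun x => f x + g x)
| trig_scale a f : trig_poly f -> trig_poly (fun x => a * f x).

Let lD u v x : l (u + v) x = l u x + l v x.
Proof. by rewrite -[u]scale1r lP mul1r scale1r. Qed.

Let l0 x : l 0 x = 0.
Proof. by have := lD 0 0 x; rewrite addr0 -[LHS]addr0 => /addrI/esym. Qed.

Let lZ a u x : l (a *: u) x = a * l u x.
Proof. by rewrite -[a *: u]addr0 lP l0 addr0. Qed.

Let lB u v x : l (u - v) x = l u x - l v x.
Proof. by rewrite lD -scaleN1r lZ mulN1r. Qed.

Let trig_eq f g : trig_poly f -> (forall x, f x = g x) -> trig_poly g.
Proof. by move=> tf /funext <-. Qed.

Let trig_measurable f : trig_poly f -> measurable_fun setT f.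
Proof.
elim=> [v|v|{}f g _ mf _ mg|a {}f _ mf].
- exact: (measurableT_comp (@measurable_cos R) (ml v)).
- exact: (measurableT_comp (@measurable_sin R) (ml v)).
- exact: measurable_funD.
- exact: measurable_funM.
Qed.

Let trig_bounded f : trig_poly f -> exists M, forall x, `|f x| <= M.
Proof.
elim=> [v|v|{}f g _ [M fM] _ [N gN]|a {}f _ [M fM]].
- by exists 1 => x; exact: cos_max.
- by exists 1 => x; exact: sin_max.
- by exists (M + N) => x; rewrite (le_trans (ler_normD _ _))// lerD.
- by exists (`|a| * M) => x; rewrite normrM ler_wpM2l.
Qed.

(** Products of cosines and sines are sums of cosines and sines. *)
Let trig_mul f g : trig_poly f -> trig_poly g -> trig_poly (fun x => f x * g x).
Proof.
move=> tf tg; elim: tf => {f} [u|u|f1 f2 _ ih1 _ ih2|a f _ ih]; last 2 first.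
- by apply: (trig_eq (trig_add ih1 ih2)) => x; rewrite mulrDl.
- by apply: (trig_eq (trig_scale a ih)) => x; rewrite mulrA.
- elim: tg => {g} [v|v|g1 g2 _ ih1 _ ih2|a g _ ih]; last 2 first.
  + by apply: (trig_eq (trig_add ih1 ih2)) => x; rewrite mulrDr.
  + by apply: (trig_eq (trig_scale a ih)) => x; rewrite mulrCA.
  + apply: (trig_eq (trig_scale 2^-1 (trig_add (trig_cos (u - v)) (trig_cos (u + v))))).
    by move=> x; rewrite lB lD cosB cosD; field.
  + apply: (trig_eq (trig_scale 2^-1 (trig_add (trig_sin (u + v))
      (trig_scale (-1) (trig_sin (u - v)))))).
    by move=> x; rewrite lB lD sinB sinD; field.
- elim: tg => {g} [v|v|g1 g2 _ ih1 _ ih2|a g _ ih]; last 2 first.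
  + by apply: (trig_eq (trig_add ih1 ih2)) => x; rewrite mulrDr.
  + by apply: (trig_eq (trig_scale a ih)) => x; rewrite mulrCA.
  + apply: (trig_eq (trig_scale 2^-1 (trig_add (trig_sin (u + v)) (trig_sin (u - v))))).
    by move=> x; rewrite lB lD sinB sinD; field.
  + apply: (trig_eq (trig_scale 2^-1 (trig_add (trig_cos (u - v))
      (trig_scale (-1) (trig_cos (u + v)))))).
    by move=> x; rewrite lB lD cosB cosD; field.
Qed.

Let trig_integrable (M : probability T R) f : trig_poly f ->
  M.-integrable setT (EFin \o f).
Proof.
move=> tf; have [K fK] := trig_bounded tf.
apply: (le_integrable measurableT _ _ (finite_measure_integrable_cst M K measurableT)).
  by apply/measurable_EFinP; exact: trig_measurable.
by move=> x _ /=; rewrite lee_fin (le_trans (fK x))// ler_norm.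
Qed.

Let trig_PQ f : trig_poly f -> (\int[P]_x (f x)%:E = \int[Q]_x (f x)%:E)%E.
Proof.
elim=> [v|v|{}f g tf hf tg hg|a {}f tf hf] //.
- under eq_integral do rewrite EFinD.
  under [in RHS]eq_integral do rewrite EFinD.
  rewrite integralD//; [|exact: trig_integrable..].
  rewrite integralD//; [|exact: trig_integrable..].
  by rewrite hf hg.
- under eq_integral do rewrite EFinM.
  under [in RHS]eq_integral do rewrite EFinM.
  by rewrite !integralZl// ?hf//; exact: trig_integrable.
Qed.

Let trig1 : trig_poly (fun=> 1).
Proof. by apply: (trig_eq (trig_cos 0)) => x; rewrite l0 cos0. Qed.

Let sin_slope (y : R) : (fun n => n.+1%:R * sin (n.+1%:R^-1 * y)) @ \oo --> y.
Proof.
have D : is_derive (0 : R) 1 (fun h : R => sin (h * y)) y.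
  by apply: is_derive_eq; rewrite mul0r cos0 /GRing.scale/=; ring.
have := @ex_derive _ _ _ _ _ _ _ D => /cvg_ex[/= a Da].
have ay : a = y by rewrite -(derive_val (is_derive := D)); apply/esym/cvg_lim.
move: Da; rewrite ay => /cvgr_dnbhsP/(_ (fun n => n.+1%:R^-1)) h.
have : (forall n : nat, n.+1%:R^-1 != 0 :> R) /\ n.+1%:R^-1 @[n --> \oo] -->
  (0 : R).
  by split; [move=> n; rewrite invr_eq0|exact: cvg_harmonic].
move=> /h; apply: cvg_trans; apply: near_eq_cvg; apply: nearW => n /=.
by rewrite invrK mul0r sin0 subr0 addr0 /GRing.scale/= mulr1.
Qed.

(** The functionals themselves are limits of the algebra, as
    [l v x] is the limit of [n * sin (l v x / n)]. *)
Lemma trigonometric_unique : exists S : set (set T),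
  (forall v, measurable_fun setT (l v : g_sigma_algebraType S -> R)) /\
  (forall A, <<s S >> A -> P A = Q A).
Proof.
exists (approximable trig_poly); split.
  move=> v; apply: (@measurable_fun_cvg _ (g_sigma_algebraType (approximable trig_poly)) R
    setT (fun n x => n.+1%:R * sin (n.+1%:R^-1 * l v x))).
    move=> n; apply: measurable_funM => //.
    apply: (algebra_measurable trig_bounded trig1
      trig_add trig_scale trig_mul).
    by apply: (trig_eq (trig_sin (n.+1%:R^-1 *: v))) => x; rewrite lZ.
  by move=> x _; exact: sin_slope.
exact: (algebra_unique trig_measurable trig1 trig_mul trig_PQ).
Qed.

End trigonometric_unique.

(** The identity is one of the functionals, so that the sigma-algebra on which
    the two laws agree contains all the Borel sets. *)
Lemma cf_unique (R : realType) (P Q : probability (measurableTypeR R) R) :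
  (forall t : R, (\int[P]_x (cos (t * x))%:E = \int[Q]_x (cos (t * x))%:E)%E) ->
  (forall t : R, (\int[P]_x (sin (t * x))%:E = \int[Q]_x (sin (t * x))%:E)%E) ->
  forall A, measurable A -> P A = Q A.
Proof.
move=> hc hs A mA.
have [||S [mS PQ]] := @trigonometric_unique _ _ R R^o P Q (fun t x => t * x) _ _ hc hs.
- by move=> a u v x; rewrite mulrDl /GRing.scale/= mulrA.
- by move=> v; exact: measurable_funM.
apply: PQ.
have := mS 1 measurableT A mA; rewrite setTI.
rewrite (_ : _ @^-1` A = A)//; apply/seteqP; split => x /=; by rewrite mul1r.
Qed.

(** * Image measures *)

Section law.
Context d d' (T : measurableType d) (T' : measurableType d') (R : realType).
Variables (M : probability T R) (X : T -> T').
Hypothesis mX : measurable_fun setT X.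

Definition law : probability T' R :=
  distribution M (HB.pack X (isMeasurableFun.Build _ _ _ _ X mX) : {mfun T >-> T'}).

Lemma lawE A : law A = M (X @^-1` A).
Proof. by []. Qed.

Lemma integral_law (f : T' -> R) : measurable_fun setT f ->
  M.-integrable setT (EFin \o f \o X) ->
  (\int[law]_y (f y)%:E = \int[M]_x (f (X x))%:E)%E.
Proof.
move=> mf iX; rewrite /law /distribution integral_pushforward//.
exact/measurable_EFinP.
Qed.

Lemma same_law (N : probability T' R) (f : T' -> R) :
  (forall B, measurable B -> M (X @^-1` B) = N B) ->
  measurable_fun setT f -> N.-integrable setT (EFin \o f) ->
  M.-integrable setT (EFin \o f \o X) /\
  (\int[M]_x (f (X x))%:E = \int[N]_y (f y)%:E)%E.
Proof.
move=> XN mf iN.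
have LN (g : T' -> \bar R) : (\int[law]_y g y = \int[N]_y g y)%E.
  by apply: eq_measure_integral => A mA _; exact: XN.
have iX : M.-integrable setT (EFin \o f \o X).
  apply/integrableP; split; first by apply/measurable_EFinP;
    exact: measurableT_comp.
  have /integrableP[_] := iN; rewrite -LN /law /distribution ge0_integral_pushforward//.
  by apply: measurableT_comp => //; exact/measurable_EFinP.
by split => //; rewrite -integral_law.
Qed.

End law.

(** * Gaussian random variables *)

Section bounded_integrable.
Context d (T : measurableType d) (R : realType) (M : probability T R).

Lemma bounded_integrable (f : T -> R) (K : R) : measurable_fun setT f ->
  (forall x, `|f x| <= K) -> M.-integrable setT (EFin \o f).
Proof.
move=> mf fK.
apply: (le_integrable measurableT _ _ (finite_measure_integrable_cst M K measurableT)).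
  exact/measurable_EFinP.
by move=> x _ /=; rewrite lee_fin (le_trans (fK x))// ler_norm.
Qed.

Lemma integrable_cos (f : T -> R) : measurable_fun setT f ->
  M.-integrable setT (fun x => (cos (f x))%:E).
Proof.
move=> mf; apply: (@bounded_integrable _ 1) => [|x]; last exact: cos_max.
exact: (measurableT_comp (@measurable_cos R) mf).
Qed.

Lemma integrable_sin (f : T -> R) : measurable_fun setT f ->
  M.-integrable setT (fun x => (sin (f x))%:E).
Proof.
move=> mf; apply: (@bounded_integrable _ 1) => [|x]; last exact: sin_max.
exact: (measurableT_comp (@measurable_sin R) mf).
Qed.

Lemma Rintegral_prob_cst (c : R) : \int[M]_x c = c.
Proof. by rewrite Rintegral_cst// [X in fine X](_ : _ = 1%E) ?mulr1//;
  exact: probability_setT. Qed.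

Lemma EFin_Rintegral (f : T -> R) : M.-integrable setT (EFin \o f) ->
  (\int[M]_x (f x)%:E = (\int[M]_x f x)%:E)%E.
Proof. by move=> i; rewrite /Rintegral fineK//; exact: integrable_fin_num. Qed.

End bounded_integrable.

Section gaussian_variable.
Context d (T : measurableType d) (R : realType) (M : probability T R).
Variables (X : T -> R).
Hypothesis mX : measurable_fun setT X.

Lemma dirac_variable a f :
  (forall B, measurable B -> M (X @^-1` B) = \d_a B) ->
  measurable_fun setT f ->
  M.-integrable setT (EFin \o f \o X) /\ (\int[M]_x (f (X x))%:E = (f a)%:E)%E.
Proof.
move=> Xa mf.
have mf' : measurable_fun setT (EFin \o f) by exact/measurable_EFinP.
have [] := @same_law _ _ _ _ _ M X mX (\d_a) f Xa mf.
  apply/integrableP; split => //.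
  rewrite integral_dirac//; first by rewrite diracT mul1e ltry.
  exact: measurableT_comp.
by move=> i ->; rewrite integral_dirac// diracT mul1e.
Qed.

(** Matching the mean and the variance identifies the parameters of the law,
    Dirac or normal, hence its moments and its characteristic function. *)
Lemma gaussian_variable (a v : R) : gaussian_real (pushforward M X) ->
  (\int[M]_x (X x)%:E = a%:E)%E ->
  (\int[M]_x (X x ^+ 2)%:E = (v + a ^+ 2)%:E)%E ->
  [/\ 0 <= v,
      forall k, (k <= 4)%N -> M.-integrable setT (fun x => ((X x - a) ^+ k)%:E),
      (\int[M]_x ((X x - a) ^+ 4)%:E = (3 * v ^+ 2)%:E)%E,
      forall t, \int[M]_x cos (t * (X x - a)) = expR (- (t ^+ 2 * v / 2)) &
      forall t, \int[M]_x sin (t * (X x - a)) = 0].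
Proof.
move=> gX EX EX2.
have mpow c k : measurable_fun setT (fun y : R => (y - c) ^+ k).
  by apply: measurable_funX; exact: measurable_funB.
have mlin (t : R) c : measurable_fun setT (fun y : R => t * (y - c)).
  by apply: measurable_funM => //; exact: measurable_funB.
have mcos (t : R) c : measurable_fun setT (fun y : R => cos (t * (y - c))) :=
  measurableT_comp (@measurable_cos R) (mlin t c).
have msin (t : R) c : measurable_fun setT (fun y : R => sin (t * (y - c))) :=
  measurableT_comp (@measurable_sin R) (mlin t c).
case: gX => [[b Xb]|[m [s [s0 Xms]]]].
- have D f := @dirac_variable b f Xb.
  have ab : b = a by have := (D id (@measurable_id _ _ _)).2; rewrite EX => -[].
  subst b; have v0 : v = 0.
    have := (D _ (mpow 0 2)).2; under eq_integral do rewrite subr0.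
    by rewrite EX2 subr0 => -[]; rewrite -[X in _ = X]add0r => /addIr.
  rewrite v0; split => //.
  + by move=> k _; exact: (D _ (mpow a k)).1.
  + by rewrite (D _ (mpow a 4)).2 subrr expr0n expr0n mulr0.
  + by move=> t; rewrite /Rintegral (D _ (mcos t a)).2 subrr mulr0 cos0 mulr0 mul0r oppr0 expR0.
  + by move=> t; rewrite /Rintegral (D _ (msin t a)).2 subrr mulr0 sin0.
- have s_neq0 : s != 0 by rewrite gt_eqF.
  have D f := @same_law _ _ T (measurableTypeR R) R M X mX (normal_prob m s) f Xms.
  have [i1 E1] := D _ (mpow m 1%N) (@normal_integrable_pow R m s s_neq0 1%N isT).
  have [i2 E2] := D _ (mpow m 2%N) (@normal_integrable_pow R m s s_neq0 2%N isT).
  rewrite normal_moment1// in E1; rewrite normal_moment2// in E2.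
  have ma : m = a.
    apply/EFin_inj; rewrite -EX.
    under eq_integral => x _ do rewrite -[X x](subrK m) EFinD.
    rewrite integralD//; last exact: finite_measure_integrable_cst.
    rewrite E1 add0e integral_cst//= [X in (_ * X)%E](_ : _ = 1%E) ?mule1//.
    exact: probability_setT.
  subst a; have vs : v = s ^+ 2.
    have i1' := integrableZl measurableT (2 * m) i1.
    have ic := finite_measure_integrable_cst M (m ^+ 2) (@measurableT _ T).
    have : (\int[M]_x (X x ^+ 2)%:E = (s ^+ 2 + m ^+ 2)%:E)%E.
      transitivity (\int[M]_x (((X x - m) ^+ 2)%:E +
        ((2 * m)%:E * ((X x - m) ^+ 1)%:E + (m ^+ 2)%:E)))%E.
        by apply: eq_integral => x _; rewrite -EFinM -!EFinD; congr EFin; ring.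
      rewrite integralD//; last exact: integrableD.
      rewrite integralD// integralZl// E1 E2 mule0 add0e integral_cst//.
      by rewrite [X in (_ * X)%E](_ : _ = 1%E) ?mule1//;
        exact: probability_setT.
    by rewrite EX2 => -[/addIr].
  rewrite vs; split.
  + exact: sqr_ge0.
  + by move=> k k4; exact: (D _ (mpow m k) (@normal_integrable_pow R m s s_neq0 k k4)).1.
  + rewrite (D _ (mpow m 4%N) (@normal_integrable_pow R m s s_neq0 4 isT)).2.
    by rewrite normal_moment4// -exprM.
  + move=> t; rewrite /Rintegral (D _ (mcos t m) _).2.
      exact: normal_cos.
    by apply: integrable_cos; apply: measurable_funM => //;
      exact: measurable_funB.
  + move=> t; rewrite /Rintegral (D _ (msin t m) _).2.
      exact: normal_sin.
    by apply: integrable_sin; apply: measurable_funM => //;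
      exact: measurable_funB.
Qed.

End gaussian_variable.

(** * Covariance of a Gaussian measure *)

Section gaussian_covariance.
Variables (R : realType) (H : hilbertType R) (mu : probability (borel H) R).
Hypothesis gmu : gaussian_measure mu.
Variables (m : H) (C : H -> H).
Hypotheses (mean_mu : is_mean mu m) (cov_mu : is_covariance mu C).

Definition centered (h : H) (x : H) : R := inner h (x - m).
Local Notation xi := centered.

Lemma measurable_centered h : measurable_fun setT (xi h : borel H -> R).
Proof.
apply: continuous_borel_measurable => x; rewrite /xi.
apply: (@continuous_comp _ _ _ (fun y => y - m) (inner h)).
  by apply: cvgB; [exact: cvg_id|exact: cvg_cst].
exact: inner_continuous.
Qed.

Lemma centeredD h k x : xi (h + k) x = xi h x + xi k x.
Proof. by rewrite /xi innerDl. Qed.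

Let cov_sqr h k : (\int[mu]_x (inner h x * inner k x)%:E =
  (inner (C h) k + inner h m * inner k m)%:E)%E.
Proof.
have [m' mean' cov'] := cov_mu.
have -> : m = m'.
  apply: inner_inj => z; rewrite ![inner _ z]innerC; apply/EFin_inj.
  by rewrite -mean_mu -mean'.
have := cov' h k; case: (\int[mu]_x _)%E => [r| |]//.
by rewrite -EFinB => -[->]; congr EFin; rewrite subrK.
Qed.

Let centered_moments h :
  [/\ 0 <= inner (C h) h,
      forall k, (k <= 4)%N -> mu.-integrable setT (fun x => (xi h x ^+ k)%:E),
      (\int[mu]_x (xi h x ^+ 4)%:E = (3 * inner (C h) h ^+ 2)%:E)%E,
      \int[mu]_x cos (xi h x) = expR (- (inner (C h) h / 2)) &
      \int[mu]_x sin (xi h x) = 0].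
Proof.
have [||q0 ik E4 Ec Es] := gaussian_variable (a := inner h m)
    (v := inner (C h) h) (measurable_inner h) (gmu h).
- exact: mean_mu.
- by under eq_integral do rewrite expr2; rewrite cov_sqr.
split => //.
- by move=> k k4; under eq_fun do rewrite /xi innerBr; exact: ik.
- by under eq_integral do rewrite /xi innerBr; exact: E4.
- have := Ec 1; rewrite expr1n mul1r => <-; apply: eq_Rintegral => x _.
  by rewrite mul1r /xi innerBr.
- have := Es 1 => <-; apply: eq_Rintegral => x _.
  by rewrite mul1r /xi innerBr.
Qed.

Lemma cov_ge0 h : 0 <= inner (C h) h.
Proof. by have [] := centered_moments h. Qed.

Lemma centered_integrable h : mu.-integrable setT (fun x => (xi h x)%:E).
Proof.
by have [_ /(_ 1%N isT) + _ _ _] := centered_moments h;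
  under eq_fun do rewrite expr1.
Qed.

Lemma centered4_integrable h : mu.-integrable setT (fun x => (xi h x ^+ 4)%:E).
Proof. by have [_ /(_ 4%N isT) + _ _ _] := centered_moments h. Qed.

Lemma centered4 h : \int[mu]_x (xi h x ^+ 4) = 3 * inner (C h) h ^+ 2.
Proof. by have [_ _ E4 _ _] := centered_moments h; rewrite /Rintegral E4. Qed.

Lemma centered_cos h : \int[mu]_x cos (xi h x) = expR (- (inner (C h) h / 2)).
Proof. by have [] := centered_moments h. Qed.

Lemma centered_sin h : \int[mu]_x sin (xi h x) = 0.
Proof. by have [] := centered_moments h. Qed.

Lemma centeredM_integrable h k :
  mu.-integrable setT (fun x => (xi h x * xi k x)%:E).
Proof.
have i2 g : mu.-integrable setT (fun x => (xi g x ^+ 2)%:E).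
  by have [_ /(_ 2%N isT) + _ _ _] := centered_moments g.
apply: (le_integrable measurableT _ _ (integrableD measurableT (i2 h) (i2 k))).
  by apply/measurable_EFinP; apply: measurable_funM; exact: measurable_centered.
move=> x _ /=; rewrite lee_fin [leRHS]ger0_norm ?addr_ge0 ?sqr_ge0// normrM.
rewrite -(real_normK (num_real (xi h x))) -(real_normK (num_real (xi k x))).
have := sqr_ge0 (`|xi h x| - `|xi k x|);
  have := sqr_ge0 (`|xi h x| + `|xi k x|).
by rewrite sqrrB sqrrD => *; lra.
Qed.

Lemma centered_mean h : \int[mu]_x xi h x = 0.
Proof.
have ic := finite_measure_integrable_cst mu (inner h m) (@measurableT _ (borel H)).
have := mean_mu h.
have -> : (\int[mu]_x (inner h x)%:E = (\int[mu]_x xi h x + inner h m)%:E)%E.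
  rewrite EFinD -EFin_Rintegral; last exact: centered_integrable.
  rewrite -{1}(Rintegral_prob_cst mu (inner h m)) -EFin_Rintegral//.
  rewrite -integralD//; last exact: centered_integrable.
  by apply: eq_integral => x _; rewrite -EFinD /xi innerBr subrK.
by move=> -[]; rewrite -[RHS]add0r => /addIr.
Qed.

Lemma covE h k : inner (C h) k = \int[mu]_x (xi h x * xi k x).
Proof.
have ic := finite_measure_integrable_cst mu (inner h m * inner k m) (@measurableT _ (borel H)).
have iM := centeredM_integrable h k.
have ih := integrableZl measurableT (inner k m) (centered_integrable h).
have ik := integrableZl measurableT (inner h m) (centered_integrable k).
have E0 g : (\int[mu]_x (xi g x)%:E = 0)%E.
  by rewrite EFin_Rintegral ?centered_mean//; exact: centered_integrable.
have : (\int[mu]_x (inner h x * inner k x)%:E =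
    (\int[mu]_x (xi h x * xi k x) + inner h m * inner k m)%:E)%E.
  transitivity (\int[mu]_x ((xi h x * xi k x)%:E + (((inner k m)%:E * (xi h x)%:E
      + (inner h m)%:E * (xi k x)%:E) + (inner h m * inner k m)%:E)))%E.
    apply: eq_integral => x _; rewrite -!EFinM -!EFinD; congr EFin.
    by rewrite /xi !innerBr; ring.
  have iD := integrableD measurableT ih ik.
  rewrite integralD//; last exact: integrableD.
  rewrite integralD// integralD// !integralZl//; try exact: centered_integrable.
  rewrite !E0 !mule0 add0e add0e EFin_Rintegral// integral_cst//.
  by rewrite [X in (_ * X)%E](_ : _ = 1%E) ?mule1//; exact: probability_setT.
by rewrite cov_sqr => -[/addIr].
Qed.

Lemma cov_sym h k : inner (C h) k = inner h (C k).
Proof.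
by rewrite [RHS]innerC !covE; apply: eq_Rintegral => x _; rewrite mulrC.
Qed.

Lemma cov_linear : linear C.
Proof.
move=> a h k; apply: inner_inj => g.
by rewrite innerDl innerZl !cov_sym innerDl innerZl.
Qed.

End gaussian_covariance.

(** * Finiteness of the second moment of a Gaussian measure *)

Lemma integrable_Rintegral_sum d (T : measurableType d) (R : realType)
    (M : {measure set T -> \bar R}) (I : Type) (r : seq I) (f : I -> T -> R) :
  (forall i, M.-integrable setT (EFin \o f i)) ->
  M.-integrable setT (EFin \o (fun x => \sum_(i <- r) f i x)) /\
  \int[M]_x (\sum_(i <- r) f i x) = \sum_(i <- r) \int[M]_x f i x.
Proof.
move=> fi.
have h s : M.-integrable setT (EFin \o (fun x => \sum_(i <- s) f i x)).
  have := integrable_sum measurableT s (P := xpredT) (fun i _ => fi i).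
  by apply: eq_integrable => // x _ /=; rewrite sumEFin.
split => //; elim: r => [|i r ih].
  under eq_Rintegral do rewrite big_nil.
  by rewrite big_nil Rintegral_cst// mul0r.
under eq_Rintegral do rewrite big_cons.
by rewrite RintegralD// ih big_cons.
Qed.

Section second_moment.
Variables (R : realType) (H : hilbertType R) (mu : probability (borel H) R).
Hypothesis gmu : gaussian_measure mu.
Variables (m : H) (C : H -> H).
Hypotheses (mean_mu : is_mean mu m) (cov_mu : is_covariance mu C).
Local Notation xi := (centered m).
Variable d : nat -> H.
Hypothesis d_dense : dense_seq setT d.
Local Notation e := (gs (fun x y : H => inner x y : R) d).

Let q h := inner (C h) h.

Lemma measurable_norm_center : measurable_fun setT (fun x : borel H => `|(x : H) - m|).
Proof.
apply: (@continuous_borel_measurable R H (fun x => `|x - m|)) => x.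
apply: (@continuous_comp _ _ _ (fun y => y - m) (fun y : H => `|y|)).
  by apply: cvgB; [exact: cvg_id|exact: cvg_cst].
exact: norm_continuous.
Qed.

Let bad (r : R) : set (borel H) := [set x | r < `|(x : H) - m|].

Let measurable_bad r : measurable (bad r).
Proof.
have -> : bad r = setT `&` (fun x : borel H => `|(x : H) - m|) @^-1` `]r,
  +oo[%classic.
  by apply/seteqP; split => x /=; rewrite in_itv/= andbT; [split|case].
by apply: measurable_norm_center => //; exact: measurable_itv.
Qed.

Let small_tail : exists r : R, fine (mu (bad r)) <= 12^-1.
Proof.
have := @nonincreasing_cvg_mu _ _ _ mu (fun n => bad n%:R).
have -> : \bigcap_n bad n%:R = set0.
  apply/seteqP; split => // x /= /(_ (Num.bound `|(x : H) - m|) I).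
  by rewrite /bad /= ltNge (ltW (archi_boundP _)).
rewrite measure0 => /(_ _ _ _ _)/fine_cvgP[].
- by rewrite (le_lt_trans (probability_le1 mu _)) ?ltry.
- by move=> i.
- exact: measurable0.
- move=> i j ij; apply/subsetPset => x; rewrite /bad /=; apply: le_lt_trans.
  by rewrite ler_nat.
move=> _ /cvgrPdist_le/(_ 12^-1 _)[//|N _ /(_ N (leqnn N))].
rewrite /= sub0r normrN => h; exists N%:R; exact: le_trans (ler_norm _) h.
Qed.

(** The partial sums [s_n] of the trace satisfy
    [s_n <= r ^+ 2 + (s_n + 1) / 2]: outside of the event of small probability
    that [x - m] is longer than [r], the partial sum of squares is at most
    [r ^+ 2], and on that event its expectation is controlled by the fourth
    moments, which are three times the squared variances. *)
Let trace_partial : exists K : R, forall n, \sum_(i < n) q (e i) <= K.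
Proof.
have [r hr] := small_tail; exists (2 * r ^+ 2 + 1) => n.
have q0 i : 0 <= q (e i) := cov_ge0 gmu mean_mu cov_mu _.
(* [w i] replaces [q (e i)], which may vanish, in the denominators below *)
pose w (i : nat) : R := q (e i) + (2^-1) ^+ i.+1.
have w0 i : 0 < w i by rewrite ltr_wpDl// exprn_gt0.
have wq i : q (e i) <= w i by rewrite lerDl exprn_ge0.
pose F (i : nat) (x : H) := (12 * w i)^-1 * xi (e i) x ^+ 4 + 3 * w i * \1_(bad r) x.
have iI : mu.-integrable setT (EFin \o (\1_(bad r) : borel H -> R)).
  exact: integrable_indic.
have i4 := fun i => centered4_integrable gmu mean_mu cov_mu (e i).
have iF1 i : mu.-integrable setT (fun x => ((12 * w i)^-1 * xi (e i) x ^+ 4)%:E).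
  by have := integrableZl measurableT (12 * w i)^-1 (i4 i);
    apply: eq_integrable.
have iF2 i : mu.-integrable setT (fun x => (3 * w i * \1_(bad r) x)%:E).
  by have := integrableZl measurableT (3 * w i) iI; apply: eq_integrable.
have iF i : mu.-integrable setT (EFin \o F i).
  by have := integrableD measurableT (iF1 i) (iF2 i); apply: eq_integrable.
have EF i : \int[mu]_x F i x <= q (e i) / 2 + (2^-1) ^+ i.+1 / 4.
  rewrite /F RintegralD; [|by []|exact: iF1|exact: iF2].
  rewrite (RintegralZl (12 * w i)^-1 measurableT (i4 i)).
  rewrite (RintegralZl (3 * w i) measurableT iI).
  rewrite (centered4 gmu mean_mu cov_mu) -/(q _).
  have -> : \int[mu]_x \1_(bad r) x = fine (mu (bad r)).
    by rewrite /Rintegral integral_indic// setIT.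
  have h1 : (12 * w i)^-1 * (3 * q (e i) ^+ 2) <= q (e i) / 4.
    rewrite mulrC ler_pdivrMr ?mulr_gt0// expr2.
    by have := ler_wpM2l (q0 i) (wq i); lra.
  have h2 : 3 * w i * fine (mu (bad r)) <= w i / 4.
    have := ler_wpM2l (ltW (w0 i)) hr; lra.
  by rewrite (le_trans (lerD h1 h2))// /w; lra.
have i2 := fun i => centeredM_integrable gmu mean_mu cov_mu (e i) (e i).
have ef : forall j, \int[mu]_x (xi (e j) x * xi (e j) x) = q (e j).
  move=> j.
  by rewrite /q (covE gmu mean_mu cov_mu).
have := @integrable_Rintegral_sum _ _ _ mu _ (index_enum 'I_n)
  (fun i x => xi (e i) x * xi (e i) x) (fun i => i2 i).
move=> [isum]; under [RHS]eq_bigr do rewrite ef; move=> Esum.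
have [iFsum EFsum] := @integrable_Rintegral_sum _ _ _ mu _ (index_enum 'I_n)
  (fun i x => F i x) (fun i => iF i).
have ic := finite_measure_integrable_cst mu (r ^+ 2) (@measurableT _ (borel H)).
have key : \sum_(i < n) q (e i) <= r ^+ 2 + \sum_(i < n) \int[mu]_x F i x.
  rewrite -Esum -EFsum -[X in X + _](Rintegral_prob_cst mu).
  rewrite -RintegralD//; apply: le_Rintegral => //.
    by have := integrableD measurableT ic iFsum; apply: eq_integrable.
  move=> x _; have [xb|xb] := boolP (x \in bad r).
    rewrite (@le_trans _ _ (\sum_(i < n) F i x))//;
      last by rewrite lerDr sqr_ge0.
    apply: ler_sum => i _; rewrite /F indicE xb mulr1 -expr2.
    set y := xi (e i) x.
    have : 0 <= (12 * w i)^-1 * (y ^+ 2 - 6 * w i) ^+ 2.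
      by rewrite mulr_ge0 ?sqr_ge0// invr_ge0 mulr_ge0// ltW.
    rewrite -subr_ge0; congr (0 <= _); field.
    by rewrite gt_eqF.
  rewrite (@le_trans _ _ (r ^+ 2))//.
    have := xb; rewrite notin_setE /bad /= => /negP; rewrite -leNgt => xr.
    rewrite (@le_trans _ _ (`|x - m| ^+ 2))//.
      have := Bessel d n (x - m); apply: le_trans; apply: ler_sum => i _.
      by rewrite expr2.
    by rewrite lerXn2r ?nnegrE// (le_trans _ xr).
  rewrite lerDl; apply: sumr_ge0 => i _; rewrite /F addr_ge0// mulr_ge0//.
  - by rewrite invr_ge0 mulr_ge0// ltW.
  - exact: exprn_even_ge0.
  - by rewrite mulr_ge0// ltW.
have geo k : \sum_(i < k) (2^-1) ^+ i.+1 / 4 <= 2^-1 :> R.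
  have -> : \sum_(i < k) (2^-1) ^+ i.+1 / 4 = (1 - 2^-1 ^+ k) / 4 :> R.
    elim: k => [|k ih]; first by rewrite big_ord0 expr0 subrr mul0r.
    by rewrite big_ord_recr /= ih exprS; field.
  have : 0 <= (2^-1) ^+ k :> R by rewrite exprn_ge0.
  by lra.
have := le_trans key (lerD (lexx (r ^+ 2)) (ler_sum _ (fun (i : 'I_n) _ => EF i))).
rewrite big_split /= -mulr_suml; have := geo n; set S := \sum_(i < n) q _; lra.
Qed.

(** Monotone convergence carries the uniform bound of the partial traces over
    to their limit, by Parseval's identity. *)
Lemma second_moment_integrable :
  mu.-integrable setT (fun x => (`|(x : H) - m| ^+ 2)%:E).
Proof.
have mN : measurable_fun setT (fun x : borel H => (`|(x : H) - m| ^+ 2)%:E).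
  by apply/measurable_EFinP; apply: measurable_funX;
    exact: measurable_norm_center.
have [K hK] := trace_partial.
apply/integrableP; split => //; apply: (@le_lt_trans _ _ K%:E);
  last exact: ltry.
pose f n (x : borel H) : \bar R := (\sum_(i < n) (xi (e i) x ^+ 2))%:E.
have mf n : measurable_fun setT (f n).
  apply/measurable_EFinP; apply: measurable_sum => i; apply: measurable_funX.
  exact: measurable_centered.
have f0 n x : setT x -> (0 <= f n x)%E.
  by move=> _; rewrite lee_fin sumr_ge0// => i _; exact: sqr_ge0.
have fnd x : setT x -> nondecreasing_seq (f ^~ x).
  move=> _; apply/nondecreasing_seqP => n; rewrite lee_fin big_ord_recr/=.
  by rewrite lerDl sqr_ge0.
have -> : (\int[mu]_x `|(`|(x : H) - m| ^+ 2)%:E| = \int[mu]_x limn (f ^~ x))%E.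
  apply: eq_integral => x _; rewrite gee0_abs ?lee_fin ?sqr_ge0//.
  apply/esym/cvg_lim => //; apply: cvg_EFin; first exact: nearW.
  exact: Parseval.
rewrite monotone_convergence//; apply: lime_le.
  apply: ereal_nondecreasing_is_cvgn => a b ab; apply: ge0_le_integral => //.
  - by move=> x _; exact: f0.
  - by move=> x _; exact: fnd.
apply: nearW => n; rewrite /f.
have [i1 E1] := @integrable_Rintegral_sum _ _ _ mu _ (index_enum 'I_n)
  (fun i x => xi (e i) x * xi (e i) x)
  (fun i => centeredM_integrable gmu mean_mu cov_mu (e i) (e i)).
under eq_integral do under eq_bigr do rewrite expr2.
rewrite EFin_Rintegral// lee_fin E1 (le_trans _ (hK n))//.
by apply: ler_sum => i _; rewrite /q (covE gmu mean_mu cov_mu).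
Qed.

End second_moment.

(** * The short of an operator as a limit of Gram-Schmidt residues *)

Section positive_operators.
Variables (R : realType) (H : hilbertType R).
Implicit Types (A X Y : H -> H).

Let sdform A : linear A -> (forall x y, inner (A x) y = inner x (A y)) ->
  (forall x y, inner (A x) y = inner (A y) x :> R) /\
  (forall a x y z, inner (A (a *: x + y)) z = a * inner (A x) z + inner (A y) z :> R).
Proof.
move=> lA sA; split => [x y|a x y z]; first by rewrite sA innerC.
by rewrite lA innerDl innerZl.
Qed.

(** The Cauchy-Schwarz inequality for the form [<A x, y>], applied to [x] and
    [A x], bounds the norm of [A x]. *)
Lemma form_bounded A K : linear A ->
  (forall x y, inner (A x) y = inner x (A y)) ->
  (forall x, 0 <= inner (A x) x) -> (forall x, inner (A x) x <= K * `|x| ^+ 2) ->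
  positive_operator A.
Proof.
move=> lA sA A0 AK; split => //; split => //; exists `|K| => x.
have [sC sP] := sdform lA sA.
have := semidefinite_CauchySchwarz sC sP A0 x (A x).
rewrite [inner (A x) (A x)]innerxx => CS.
have [->|Ax0] := eqVneq `|A x| 0; first by rewrite mulr_ge0.
have Axp : 0 < `|A x| by rewrite lt_neqAle eq_sym Ax0 normr_ge0.
have AK' y : inner (A y) y <= `|K| * `|y| ^+ 2.
  by rewrite (le_trans (AK y))// ler_wpM2r// ?sqr_ge0// ler_norm.
have := le_trans CS (ler_pM (A0 _) (A0 _) (AK' x) (AK' (A x))).
rewrite (_ : _ * _ * _ = (`|K| * `|x|) ^+ 2 * `|A x| ^+ 2); last by ring.
rewrite [leLHS]expr2 ler_pM2r ?exprn_gt0//.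
by rewrite ler_pXn2r ?nnegrE ?mulr_ge0.
Qed.

Lemma zero_form A : linear A -> (forall x y, inner (A x) y = inner x (A y)) ->
  (forall x, inner (A x) x = 0) -> forall x, A x = 0.
Proof.
move=> lA sA A0 x; have [sC sP] := sdform lA sA.
have A0' y : 0 <= inner (A y) y :> R by rewrite A0.
apply: inner_inj => y; rewrite inner0l.
exact: (semidefinite_eq0 sC sP A0').
Qed.

Lemma op_le_anti X Y : op_le X Y -> op_le Y X -> X = Y.
Proof.
move=> [[lXY _] sXY XY] [_ _ YX]; apply/funext => x.
have h y : inner (Y y - X y) y = 0.
  apply/eqP; rewrite eq_le XY andbT.
  by have := YX y; rewrite !innerBl; lra.
by apply/eqP; rewrite -subr_eq0 -oppr_eq0 opprB (zero_form lXY sXY h).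
Qed.

Lemma short_unique (S : set H) A X : is_short S A X -> short S A = X.
Proof.
move=> hX; have [hs1 hs2] : is_short S A (short S A).
  by apply: xgetPex; exists X.
by case: hX => hX1 hX2; apply: op_le_anti; [exact: hX2|exact: hs2].
Qed.

End positive_operators.

Section gs_member.
Variables (R : realType) (H : hilbertType R) (b : H -> H -> R) (S : set H).
Hypothesis Ssub : closed_subspace S.
Variable d : nat -> H.
Hypothesis Sd : forall n, S (d n).

Let SD (a : R) x y : S x -> S y -> S (a *: x + y).
Proof. by have [_ _ + ] := Ssub; exact. Qed.
Let S0 : S 0. Proof. by have [] := Ssub. Qed.

Let S_res n h : S h -> S (gs_res b d n h).
Proof.
elim: n h => [//|n ih] h Sh; rewrite gs_resS.
rewrite addrC -scaleNr; apply: SD; last exact: ih.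
by rewrite /gs /normalize -[_ *: gs_res _ _ _ _]addr0; apply: SD => //;
  exact: ih.
Qed.

Lemma gs_mem n : S (gs b d n).
Proof.
by rewrite /gs /normalize -[_ *: gs_res _ _ _ _]addr0; apply: SD => //;
  exact: S_res.
Qed.

Lemma subspace_sum I (r : seq I) (P : pred I) (a : I -> R) (F : I -> H) :
  (forall i, S (F i)) -> S (\sum_(i <- r | P i) a i *: F i).
Proof.
by move=> SF; elim/big_rec: _ => // i x _ Sx; exact: SD.
Qed.

End gs_member.

Section short_operator.
Variables (R : realType) (H : hilbertType R) (H1 H2 : set H).
Hypothesis H12 : orthogonal_direct_sum H1 H2.
Variables (C : H -> H) (K : R).
Hypothesis C_linear : linear C.
Hypothesis C_sym : forall x y, inner (C x) y = inner x (C y).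
Hypothesis C_ge0 : forall x, 0 <= inner (C x) x.
Hypothesis C_le : forall x, inner (C x) x <= K * `|x| ^+ 2.
Variable d : nat -> H.
Hypothesis d_dense : dense_seq H2 d.

Definition cov_form (x y : H) : R := inner (C x) y.
Local Notation b := cov_form.
Local Notation k := (gs b d).
Local Notation r := (gs_res b d).
Hypothesis Ck_sum : forall n, \sum_(i < n) `|C (k i)| ^+ 2 <= K.

Lemma cov_formC x y : b x y = b y x.
Proof. by rewrite /b C_sym innerC. Qed.

Lemma cov_formP (a : R) x y z : b (a *: x + y) z = a * b x z + b y z.
Proof. by rewrite /b C_linear innerDl innerZl. Qed.

Lemma cov_form_ge0 x : 0 <= b x x. Proof. exact: C_ge0. Qed.

Let C0 : C 0 = 0.
Proof.
have := C_linear 1 0 0; rewrite !scale1r addr0 => h.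
by move: h; rewrite -[LHS]addr0 => /addrI/esym.
Qed.

Let C_sum I (s : seq I) (a : I -> R) (F : I -> H) :
  C (\sum_(i <- s) a i *: F i) = \sum_(i <- s) a i *: C (F i).
Proof.
elim: s => [|i s ih]; first by rewrite !big_nil C0.
by rewrite !big_cons C_linear ih.
Qed.

Let CB x y : C (x - y) = C x - C y.
Proof. by rewrite addrC -scaleN1r C_linear scaleN1r addrC. Qed.

(** The residue [r_n h] differs from [h] by an element of [H2], and among such
    elements it comes closer and closer to minimizing the form of [C]. The short
    of [C] is given by the minimal value, [<S h, h> = inf <C (h + g), h + g>]
    over [g] in [H2]. *)
Definition short_seq h n : H := C (r n h).

(** The terms of the series are bounded by [`|C (k i)| ^+ 2 * `|h|], so that it
    converges absolutely. *)
Lemma short_seq_cvg h : cvgn (short_seq h).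
Proof.
have -> : short_seq h = (fun n => C h - series (fun i => b (k i) h *: C (k i)) n).
  apply/funext => n; rewrite /short_seq gs_resE CB; congr (_ - _).
  by rewrite C_sum /series /= big_mkord.
apply: is_cvgB; first exact: is_cvg_cst.
apply: normed_cvg.
have K0 : 0 <= K by have := Ck_sum 0; rewrite big_ord0.
apply: nondecreasing_is_cvgn.
  by apply: nondecreasing_series => i _ _; exact: normr_ge0.
exists (K * `|h|) => _ [n _ <-] /=; rewrite seriesEord /=.
rewrite (@le_trans _ _ ((\sum_(i < n) `|C (k i)| ^+ 2) * `|h|))//.
  rewrite mulr_suml; apply: ler_sum => i _; rewrite normrZ expr2 mulrAC.
  by rewrite ler_wpM2r// CauchySchwarz.
by rewrite ler_wpM2r.
Qed.

Definition short_lim h : H := limn (short_seq h).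
Local Notation S := short_lim.

Lemma short_limE h g : (fun n => b (r n h) g) @ \oo --> inner (S h) g.
Proof.
rewrite innerC; under eq_fun do rewrite /b innerC.
apply: (@continuous_cvg _ _ _ _ _ (short_seq h) (inner g)).
  exact: inner_continuous.
exact: short_seq_cvg.
Qed.

Let cvgR_unique (u : nat -> R) (x y : R) : u @ \oo --> x -> u @ \oo --> y ->
  x = y.
Proof. by move=> ux uy; exact: (cvg_unique _ ux uy). Qed.

Let S_linear : linear S.
Proof.
move=> a x y; apply: inner_inj => g; apply: cvgR_unique;
  first exact: short_limE.
rewrite innerDl innerZl; under eq_fun do
  rewrite (gs_res_linear cov_formC cov_formP) cov_formP.
apply: cvgD; last exact: short_limE.
by apply: cvgM; [exact: cvg_cst|exact: short_limE].
Qed.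

Let S_sym x y : inner (S x) y = inner x (S y).
Proof.
apply: cvgR_unique; first exact: short_limE; rewrite innerC.
under eq_fun do rewrite (gs_res_adj cov_formC cov_formP) cov_formC.
exact: short_limE.
Qed.

Let r_idem n h : b (r n h) (r n h) = b (r n h) h.
Proof. exact: (gs_res_idem cov_formC cov_formP cov_form_ge0). Qed.

Lemma short_lim_form h : (fun n => b (r n h) (r n h)) @ \oo --> inner (S h) h.
Proof. by under eq_fun do rewrite r_idem; exact: short_limE. Qed.

Let S_ge0 h : 0 <= inner (S h) h.
Proof.
apply: (cvgr_to_ge (@short_lim_form h)); apply: nearW => n.
exact: cov_form_ge0.
Qed.

Let r_le n h : b (r n h) (r n h) <= b h h.
Proof.
rewrite (gs_res_sqr cov_formC cov_formP cov_form_ge0) gerBl.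
by apply: sumr_ge0 => i _; exact: sqr_ge0.
Qed.

Let S_le h : inner (S h) h <= inner (C h) h.
Proof.
apply: (cvgr_to_le (@short_lim_form h)); apply: nearW => n; exact: r_le.
Qed.

(** For [g = d_j] the sequence vanishes from rank [j + 1] on; the general case
    follows by density. *)
Lemma short_lim_orth h g : H2 g -> inner (S h) g = 0.
Proof.
move=> Hg; apply/eqP; rewrite -normr_eq0 eq_le normr_ge0 andbT.
apply/ler_addgt0Pr => e e0; rewrite add0r.
have [j dj] := d_dense.2 g Hg (e / (`|S h| + 1)) (ltac:(by rewrite divr_gt0// ltr_wpDl)).
have -> : inner (S h) g = inner (S h) (g - d j).
  rewrite innerBr (_ : inner (S h) (d j) = 0) ?subr0//.
  apply: cvgR_unique; first exact: short_limE; apply: cvg_near_cst.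
  exists j.+1 => // n /= jn; exact: (gs_res_orth cov_formC cov_formP cov_form_ge0).
rewrite (le_trans (CauchySchwarz _ _))//.
move: dj; rewrite ltr_pdivlMr ?ltr_wpDl// => dj.
by rewrite mulrC (le_trans _ (ltW dj))// ler_wpM2l// lerDl.
Qed.

Let K0 : 0 <= K. Proof. by have := Ck_sum 0; rewrite big_ord0. Qed.

(** If [X <= C] has its range in [H1], then [X] vanishes on [H2], so that
    [<X h, h>] equals [<X (r_n h), r_n h> <= <C (r_n h), r_n h>], and the right
    hand side tends to [<S h, h>]. *)
Lemma short_lim_is_short : is_short H1 C S.
Proof.
have [cH1 cH2 orth dec] := H12.
have d2 n : H2 (d n) := d_dense.1 n.
have posS : positive_operator S.
  apply: (@form_bounded _ _ S K S_linear S_sym S_ge0) => x.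
  exact: le_trans (S_le x) (C_le x).
split.
  split => //.
  - apply: (@form_bounded _ _ (fun x => C x - S x) K).
    + move=> a x y; rewrite C_linear S_linear scalerBr.
      by rewrite opprD addrACA.
    + by move=> x y; rewrite innerBl innerBr C_sym S_sym.
    + by move=> x; rewrite innerBl subr_ge0.
    + by move=> x; rewrite innerBl (le_trans _ (C_le x))// gerBl.
  - move=> _ [h _ <-]; have [x [y [Hx Hy Sxy]]] := dec (S h).
    suff y0 : y = 0 by rewrite Sxy y0 addr0.
    apply/eqP; rewrite -normr_eq0 -sqrf_eq0 -innerxx; apply/eqP.
    have := short_lim_orth h Hy; rewrite Sxy innerDl (orth x y Hx Hy) add0r.
    exact.
move=> X [[[lX [M XM]] sX X0] [_ _ XC] RX].
have XH2 u : H2 u -> X u = 0.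
  move=> Hu; apply: inner_inj => g; rewrite inner0l sX innerC.
  by apply: orth => //; apply: RX; exists g.
have Xr n h : X (r n h) = X h.
  rewrite gs_resE addrC -scaleN1r lX XH2 ?scaler0 ?add0r//.
  by apply: subspace_sum => // i; exact: gs_mem.
split.
- split; first by move=> a x y; rewrite lX S_linear scalerBr opprD addrACA.
  have [[_ [N SN]] _ _] := posS; exists (N + M) => x.
  by rewrite (le_trans (ler_normB _ _))// mulrDl lerD.
- by move=> x y; rewrite innerBl innerBr sX S_sym.
- move=> h; rewrite innerBl subr_ge0.
  apply: (cvgr_to_ge (@short_lim_form h)); apply: nearW => n.
  have := XC (r n h); rewrite innerBl subr_ge0; apply: le_trans.
  by rewrite Xr [leRHS]sX Xr sX.
Qed.

End short_operator.

(** * The regression series *)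

Section regression_bounds.
Variables (R : realType) (H : hilbertType R) (mu : probability (borel H) R).
Hypothesis gmu : gaussian_measure mu.
Variables (m : H) (C : H -> H).
Hypotheses (mean_mu : is_mean mu m) (cov_mu : is_covariance mu C).
Local Notation xi := (centered m).
Local Notation b := (cov_form C).
Variable d : nat -> H.
Local Notation k := (gs b d).
Hypothesis second_moment :
  mu.-integrable setT (fun x => (`|(x : H) - m| ^+ 2)%:E).

(** This is the trace of [C]. *)
Definition total_variance : R := \int[mu]_x (`|(x : H) - m| ^+ 2).
Local Notation K := total_variance.

Let C_sym := cov_sym gmu mean_mu cov_mu.
Let C_linear := cov_linear gmu mean_mu cov_mu.
Let C_ge0 := cov_ge0 gmu mean_mu cov_mu.
Let bC := cov_formC C_sym.
Let bP := cov_formP C_linear.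
Let b_ge0 := cov_form_ge0 C_ge0.

Lemma cov_le h : inner (C h) h <= K * `|h| ^+ 2.
Proof.
rewrite (covE gmu mean_mu cov_mu) /K mulrC -RintegralZl//.
apply: le_Rintegral => //.
- exact: (centeredM_integrable gmu mean_mu cov_mu).
- by have := integrableZl measurableT (`|h| ^+ 2) second_moment;
    apply: eq_integrable.
- move=> x _; rewrite -expr2 -exprMn -[leLHS]real_normK ?num_real//.
  by rewrite lerXn2r ?nnegrE ?mulr_ge0// CauchySchwarz.
Qed.

Let bk i : b (k i) (k i) * `|C (k i)| ^+ 2 = `|C (k i)| ^+ 2.
Proof.
have [->|->] := gs_norm bC bP b_ge0 d i; first by rewrite mul1r.
have C0 : C 0 = 0.
  by apply: inner_inj => z; rewrite C_sym !inner0l.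
by rewrite C0 normr0 expr0n mulr0.
Qed.

Let norm_sum (s : seq nat) (a : nat -> R) (v : nat -> H) :
  `|\sum_(i <- s) a i *: v i| ^+ 2 =
  \sum_(i <- s) \sum_(j <- s) a i * a j * inner (v i) (v j).
Proof.
rewrite -innerxx inner_suml; apply: eq_bigr => i _.
rewrite inner_sumr; apply: eq_bigr => j _.
by rewrite innerZl innerZr mulrA.
Qed.

(** For [w = x - m] this is the best linear prediction of [x - m] from its
    coordinates along the vectors [k_i], as [C (k i)] is the expectation of
    [<k_i, x - m> (x - m)]. *)
Definition regression (s : seq nat) (w : H) : H :=
  \sum_(i <- s) inner (k i) w *: C (k i).

Let iM i j : mu.-integrable setT
  (EFin \o (fun x => xi (k i) x * xi (k j) x * inner (C (k i)) (C (k j)))).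
Proof.
have := integrableZl measurableT (inner (C (k i)) (C (k j)))
  (centeredM_integrable gmu mean_mu cov_mu (k i) (k j)).
by apply: eq_integrable => // x _ /=; rewrite -EFinM mulrC.
Qed.

(** The coordinates of [x - m] along the Gram-Schmidt vectors are uncorrelated
    with variance [1] or [0], hence the cross terms have expectation zero. *)
Lemma regression_norm s : uniq s ->
  mu.-integrable setT (fun x => (`|regression s ((x : H) - m)| ^+ 2)%:E) /\
  \int[mu]_x (`|regression s ((x : H) - m)| ^+ 2) = \sum_(i <- s) `|C (k i)| ^+ 2.
Proof.
move=> us.
have h i := @integrable_Rintegral_sum _ _ _ mu _ s
  (fun j x => xi (k i) x * xi (k j) x * inner (C (k i)) (C (k j))) (iM i).
have [h1 h2] := @integrable_Rintegral_sum _ _ _ mu _ s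
  (fun i x => \sum_(j <- s) xi (k i) x * xi (k j) x * inner (C (k i)) (C (k j)))
  (fun i => (h i).1).
split.
  by apply: eq_integrable h1 => // x _ /=; rewrite norm_sum.
under eq_Rintegral do rewrite norm_sum.
rewrite h2 [RHS]big_seq [LHS]big_seq; apply: eq_bigr => i si; rewrite (h i).2.
have E j : \int[mu]_x (xi (k i) x * xi (k j) x * inner (C (k i)) (C (k j))) =
    b (k i) (k j) * inner (C (k i)) (C (k j)).
  rewrite [b _ _](covE gmu mean_mu cov_mu) [RHS]mulrC -RintegralZl//.
    by apply: eq_Rintegral => x _; rewrite mulrC.
  exact: (centeredM_integrable gmu mean_mu cov_mu).
rewrite (bigD1_seq i)//= E innerxx bk big1_seq ?addr0// => j /andP[ji _].
by rewrite E (gs_orth bC bP b_ge0) ?mul0r// eq_sym.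
Qed.

(** Expand [0 <= E `|x - m - z| ^+ 2], where [z] is the [n]-th partial
    regression: both [E <x - m, z>] and [E `|z| ^+ 2] are equal to the sum. *)
Lemma gs_variance_sum n : \sum_(i < n) `|C (k i)| ^+ 2 <= K.
Proof.
have [iN EN] := @regression_norm (index_iota 0 n) (iota_uniq _ _).
have iX i : mu.-integrable setT (EFin \o (fun x => xi (k i) x * xi (C (k i)) x)).
  exact: (centeredM_integrable gmu mean_mu cov_mu).
have [iS ES] := @integrable_Rintegral_sum _ _ _ mu _ (index_iota 0 n) _ iX.
have EX i : \int[mu]_x (xi (k i) x * xi (C (k i)) x) = `|C (k i)| ^+ 2.
  by rewrite -(covE gmu mean_mu cov_mu) innerxx.
have pw x : 2 * (\sum_(i <- index_iota 0 n) xi (k i) x * xi (C (k i)) x) <=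
    `|(x : H) - m| ^+ 2 + `|regression (index_iota 0 n) ((x : H) - m)| ^+ 2.
  have -> : \sum_(i <- index_iota 0 n) xi (k i) x * xi (C (k i)) x =
      inner (x - m) (regression (index_iota 0 n) (x - m)).
    rewrite inner_sumr; apply: eq_bigr => i _.
    by rewrite innerZr [inner _ (C _)]innerC.
  move: (x - m) => y; move: (regression _ y) => z; have := sqr_ge0 `|y - z|.
  by rewrite -!innerxx !(innerBl, innerBr) [inner z y]innerC; lra.
have iD := integrableD measurableT second_moment iN.
have : \int[mu]_x (2 * (\sum_(i <- index_iota 0 n) xi (k i) x * xi (C (k i)) x)) <=
    \int[mu]_x (`|(x : H) - m| ^+ 2 + `|regression (index_iota 0 n) ((x : H) - m)| ^+ 2).
  apply: le_Rintegral => //.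
  by have := integrableZl measurableT 2 iS; apply: eq_integrable.
rewrite RintegralZl// RintegralD// EN ES; under eq_bigr do rewrite EX.
by rewrite -/K big_mkord; lra.
Qed.

End regression_bounds.

Section regression_limit.
Variables (R : realType) (H : hilbertType R) (mu : probability (borel H) R).
Hypothesis gmu : gaussian_measure mu.
Variables (m : H) (C : H -> H).
Hypotheses (mean_mu : is_mean mu m) (cov_mu : is_covariance mu C).
Local Notation xi := (centered m).
Local Notation b := (cov_form C).
Variable d : nat -> H.
Local Notation k := (gs b d).
Hypothesis second_moment :
  mu.-integrable setT (fun x => (`|(x : H) - m| ^+ 2)%:E).
Local Notation K := (total_variance mu m).

(** Blocks of consecutive indices whose contributions to the total variance
    decay geometrically. *)
Lemma block_bounds : exists M : nat -> nat, [/\ M 0%N = 0%N,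
  forall j, (M j < M j.+1)%N &
  forall j, \sum_(i <- index_iota (M j) (M j.+1)) `|C (k i)| ^+ 2 <=
            (K + 1) * (2^-1) ^+ j ^+ 2].
Proof.
pose u n : R := \sum_(0 <= i < n) `|C (k i)| ^+ 2.
have uK n : u n <= K.
  rewrite /u big_mkord; exact: (gs_variance_sum gmu mean_mu cov_mu).
have und : {homo u : a c / (a <= c)%N >-> a <= c}.
  move=> a c ac; rewrite /u (big_cat_nat (leq0n a) ac)/= lerDl.
  by apply: sumr_ge0 => i _; exact: sqr_ge0.
have K0 : 0 <= K by rewrite (le_trans _ (uK 0))// /u big_geq.
have cu : cvgn u.
  apply: nondecreasing_is_cvgn; first exact: und.
  by exists K => _ [n _ <-].
have ul n : u n <= limn u by apply: nondecreasing_cvgn_le => //; exact: und.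
have /choice[g hg] : forall j, exists N : nat,
    limn u - u N <= (K + 1) * (2^-1) ^+ j ^+ 2.
  move=> j.
  have e0 : 0 < (K + 1) * (2^-1) ^+ j ^+ 2.
    by rewrite mulr_gt0 ?ltr_wpDl// !exprn_gt0.
  have /cvgrPdist_le/(_ _ e0)[N _ /(_ N (leqnn N))] := cu.
  by exists N; rewrite (le_trans (ler_norm _)).
pose M := fix M j := if j is j'.+1 then (M j' + (g j).+1)%N else 0%N.
exists M; split => // j.
  by rewrite /= addnS ltnS leq_addr.
have Mle : (M j <= M j.+1)%N by rewrite /= leq_addr.
have -> : \sum_(i <- index_iota (M j) (M j.+1)) `|C (k i)| ^+ 2 = u (M j.+1) - u (M j).
  by rewrite /u (@big_cat_nat _ _ _ (M j) 0 (M j.+1))//= addrAC subrr add0r.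
case: j Mle => [|j] _.
  rewrite expr0 expr1n mulr1 (le_trans (lerB (uK _) (und 0 _ _)))// /u big_geq// subr0.
  by rewrite lerDl.
rewrite (le_trans _ (hg j.+1))// lerB//; apply: und => /=.
by rewrite addnS ltnW// ltnS leq_addl.
Qed.

Local Notation regress := (regression C d).

Section blocks.
Variable M : nat -> nat.
Hypothesis M0 : M 0%N = 0%N.
Hypothesis MS : forall j, (M j < M j.+1)%N.
Hypothesis M_block : forall j,
  \sum_(i <- index_iota (M j) (M j.+1)) `|C (k i)| ^+ 2 <= (K + 1) * (2^-1) ^+ j ^+ 2.

Definition block j (w : H) : H := regress (index_iota (M j) (M j.+1)) w.

Let sum_block n w : \sum_(j < n) block j w = regress (index_iota 0 (M n)) w.
Proof.
elim: n => [|n ih]; first by rewrite big_ord0 M0 /regression big_geq.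
by rewrite big_ord_recr/= ih /block /regression -big_cat_nat// ltnW.
Qed.

Let regress_continuous s : continuous (regress s).
Proof.
elim: s => [|i s ih] w.
  rewrite (_ : regress [::] = fun=> 0); first exact: cvg_cst.
  by apply/funext => y; rewrite /regression big_nil.
rewrite (_ : regress (i :: s) = fun y => inner (k i) y *: C (k i) + regress s y).
  apply: cvgD; last exact: ih.
  by apply: cvgZ; [exact: inner_continuous|exact: cvg_cst].
by apply/funext => y; rewrite /regression big_cons.
Qed.

Let measurable_norm_block j : measurable_fun setT (fun w : borel H => `|block j w|).
Proof.
apply: (@continuous_borel_measurable R H (fun w => `|block j w|)) => w.
apply: (@continuous_comp _ _ _ (block j) (fun y : H => `|y|)).
  exact: regress_continuous.
exact: norm_continuous.
Qed.

Let Phi (w : borel H) : \bar R := (\sum_(j <oo) `|block j w|%:E)%E.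

Let measurable_Phi : measurable_fun setT Phi.
Proof.
apply: ge0_emeasurable_sum => // j _.
by apply/measurable_EFinP; exact: measurable_norm_block.
Qed.

(** On this set of full measure the block sums converge absolutely. Outside of
    it the partial sums are replaced by zero, so that the limit exists
    everywhere; the set depends only on the coordinates along the [k_i], hence
    so does the limit. *)
Definition summable_blocks : set (borel H) := [set w | (Phi w < +oo)%E].
Local Notation good := summable_blocks.

Let measurable_good : measurable good.
Proof.
have -> : good = setT `&` Phi @^-1` [set y | (y < +oo)%E].
  by rewrite setTI.
apply: measurable_Phi => //.
rewrite (_ : [set y | _] = ~` [set +oo%E]); first exact: measurableC.
apply/seteqP; split => y /=; first by move=> + yoo; rewrite yoo ltxx.
by move=> yoo; rewrite ltey; apply/eqP.
Qed.

Let good_cvg w : good w -> cvgn (fun n => regress (index_iota 0 (M n)) w).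
Proof.
move=> gw; have -> : (fun n => regress (index_iota 0 (M n)) w) = series (fun j => block j w).
  by apply/funext => n; rewrite seriesEord /= sum_block.
apply: normed_cvg; apply: nondecreasing_is_cvgn.
  by apply: nondecreasing_series => i _ _; exact: normr_ge0.
have P0 : (0 <= Phi w)%E by apply: nneseries_ge0.
have Pfin : Phi w \is a fin_num by rewrite ge0_fin_numE.
exists (fine (Phi w)) => _ [n _ <-] /=.
rewrite -lee_fin fineK// /series/= -sumEFin.
by apply: nneseries_lim_ge => j _ _; rewrite lee_fin.
Qed.

Definition regression_lim (w : H) : H :=
  limn (fun n => (\1_good w : R) *: regress (index_iota 0 (M n)) w).
Local Notation Lam := regression_lim.

Let cutoff_cvg w :
  (fun n => (\1_good w : R) *: regress (index_iota 0 (M n)) w) @ \oo --> Lam w.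
Proof.
suff : cvgn (fun n => (\1_good w : R) *: regress (index_iota 0 (M n)) w) by [].
rewrite indicE; have [/set_mem gw|_] := boolP (w \in good).
  by under eq_fun do rewrite scale1r; exact: good_cvg.
by under eq_fun do rewrite scale0r; exact: is_cvg_cst.
Qed.

Lemma regression_lim_measurable h :
  measurable_fun setT (fun w : borel H => inner h (Lam w)).
Proof.
apply: (@measurable_fun_cvg _ (borel H) R setT (fun n w =>
  \1_good w * \sum_(i <- index_iota 0 (M n)) inner (k i) w * inner h (C (k i)))).
  move=> n; apply: measurable_funM; first exact: measurable_indic.
  apply: measurable_sum => i; apply: measurable_funM => //.
  exact: measurable_inner.
move=> w _.
rewrite [X in X @ _ --> _](_ : _ = (fun n =>
    inner h ((\1_good w : R) *: regress (index_iota 0 (M n)) w))).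
  apply: (@continuous_cvg _ _ _ _ _ _ (inner h)); last exact: cutoff_cvg.
  exact: inner_continuous.
apply/funext => n; rewrite innerZr /regression inner_sumr; congr (_ * _).
by apply: eq_bigr => i _; rewrite innerZr.
Qed.

Lemma regression_lim_ext w w' : (forall i, inner (k i) w = inner (k i) w') ->
  Lam w = Lam w'.
Proof.
move=> ww'; have rE s : regress s w = regress s w'.
  by apply: eq_bigr => i _; rewrite ww'.
have PE : Phi w = Phi w' by apply: eq_eseriesr => j _; rewrite /block rE.
rewrite /Lam; congr (limn _); apply/funext => n; rewrite rE.
by rewrite !indicE (_ : (w \in good) = (w' \in good))//; apply/idP/idP;
  rewrite !inE /good /= PE.
Qed.

(** The bound [y <= e / 2 + y ^+ 2 / (2 e)] with [e] equal to [2 ^- j] converts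
    the bound on the second moment of the block into one on its first moment. *)
Let block_mean j : (\int[mu]_x `|block j ((x : H) - m)|%:E <=
  ((K + 2) / 2 * (2^-1) ^+ j)%:E)%E.
Proof.
have [iN EN] := regression_norm gmu mean_mu cov_mu d
  (iota_uniq (M j) (M j.+1 - M j)).
have e0 : 0 < (2^-1) ^+ j :> R by rewrite exprn_gt0.
set e := (2^-1) ^+ j in e0 *.
pose F (x : H) : R := 2^-1 * e + (2 * e)^-1 * `|block j (x - m)| ^+ 2.
have ic := finite_measure_integrable_cst mu (2^-1 * e) (@measurableT _ (borel H)).
have iZ : mu.-integrable setT (fun x => ((2 * e)^-1 * `|block j ((x : H) - m)| ^+ 2)%:E).
  by have := integrableZl measurableT ((2 * e)^-1) iN; apply: eq_integrable.
have iF : mu.-integrable setT (EFin \o F).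
  by have := integrableD measurableT ic iZ; apply: eq_integrable.
apply: (@le_trans _ _ (\int[mu]_x (F x)%:E)%E).
  apply: ge0_le_integral => //.
  - apply/measurable_EFinP.
    apply: (@continuous_borel_measurable R H (fun x => `|block j (x - m)|)) =>
      x.
    apply: (@continuous_comp _ _ _ (fun y => y - m) (fun y : H => `|block j y|)).
      by apply: cvgB; [exact: cvg_id|exact: cvg_cst].
    apply: (@continuous_comp _ _ _ (block j) (fun y : H => `|y|)).
      exact: regress_continuous.
    exact: norm_continuous.
  - by case/integrableP: iF.
  - move=> x _; rewrite lee_fin /F; set y := `|block _ _|.
    have : 0 <= (2 * e)^-1 * (y - e) ^+ 2.
      by rewrite mulr_ge0 ?sqr_ge0// invr_ge0 mulr_ge0// ltW.
    rewrite -subr_ge0; congr (0 <= _); field.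
    by rewrite gt_eqF.
rewrite EFin_Rintegral// lee_fin /F RintegralD//.
rewrite Rintegral_prob_cst (RintegralZl _ measurableT iN) EN.
have := M_block j; rewrite -/e; set T := \sum_(i <- _) _ => hT.
have -> : (K + 2) / 2 * e = 2^-1 * e + (2 * e)^-1 * ((K + 1) * e ^+ 2).
  by field; rewrite gt_eqF.
by rewrite lerD2l ler_wpM2l// invr_ge0 mulr_ge0// ltW.
Qed.

Let ae_good : {ae mu, forall x : borel H, good ((x : H) - m)}.
Proof.
have mP : measurable_fun setT (fun x : borel H => Phi ((x : H) - m)).
  exact: (measurableT_comp measurable_Phi (translation_measurable m)).
have P0 x : (0 <= Phi x)%E by apply: nneseries_ge0.
have iP : mu.-integrable setT (fun x : borel H => Phi ((x : H) - m)).
  apply/integrableP; split => //.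
  under eq_integral do rewrite gee0_abs//.
  apply: (@le_lt_trans _ _ (K + 2)%:E); last exact: ltry.
  rewrite /Phi integral_nneseries//; last first.
    move=> j; apply/measurable_EFinP.
    exact: (measurableT_comp (measurable_norm_block j) (translation_measurable m)).
  apply: lime_le.
    by apply: is_cvg_nneseries => j _ _; exact: integral_ge0.
  apply: nearW => n.
  rewrite (le_trans (lee_sum _ (fun j _ => block_mean j)))// sumEFin lee_fin.
  have -> : \sum_(0 <= j < n) (K + 2) / 2 * (2^-1) ^+ j = (K + 2) * (1 - (2^-1) ^+ n).
    elim: n => [|n ih]; first by rewrite big_geq// expr0 subrr mulr0.
    by rewrite big_nat_recr//= ih exprS; field.
  have K0 : 0 <= K.
    have := gs_variance_sum gmu mean_mu cov_mu d second_moment 0.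
    by rewrite big_ord0.
  have : 0 <= (2^-1) ^+ n :> R by rewrite exprn_ge0.
  by move=> h; rewrite ler_piMr ?addr_ge0// gerBl.
have := integrable_ae measurableT iP; apply: filterS => x /(_ I).
by rewrite ge0_fin_numE.
Qed.

Lemma regression_lim_ae : {ae mu, forall x : borel H, forall h : H,
  (fun n => xi (gs_res b d (M n) h) x) @ \oo -->
    inner h ((x : H) - m - Lam ((x : H) - m))}.
Proof.
move: ae_good; apply: filterS => x gx h.
have C_sym := cov_sym gmu mean_mu cov_mu.
have -> : (fun n => xi (gs_res b d (M n) h) x) =
  (fun n => inner h (x - m) - inner h
    ((\1_good (x - m) : R) *: regress (index_iota 0 (M n)) (x - m))).
  apply/funext => n; rewrite indicE mem_set// scale1r /regression inner_sumr.
  rewrite /centered gs_resE innerBl inner_suml big_mkord; congr (_ - _).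
  apply: eq_bigr => i _; rewrite innerZl innerZr mulrC; congr (_ * _).
  by rewrite /cov_form C_sym innerC C_sym.
rewrite [X in _ --> X]innerBr; apply: cvgB; first exact: cvg_cst.
apply: (@continuous_cvg _ _ _ _ _ _ (inner h)); last exact: cutoff_cvg.
exact: inner_continuous.
Qed.

End blocks.

(** The conditional expectation of [x - m] given the [d_i]-components of
    [x - m], as an everywhere defined measurable function of these components,
    together with the subsequence along which the partial regressions converge
    to it. *)
Lemma regression_limit : exists (Lam : H -> H) (M : nat -> nat), [/\
  forall h, measurable_fun setT (fun w : borel H => inner h (Lam w)),
  forall w w', (forall i, inner (k i) w = inner (k i) w') -> Lam w = Lam w',
  M @ \oo --> \oo &
  {ae mu, forall x : borel H, forall h : H,
    (fun n => xi (gs_res b d (M n) h) x) @ \oo -->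
      inner h ((x : H) - m - Lam ((x : H) - m))}].
Proof.
have [M [M0 MS Mb]] := block_bounds.
exists (regression_lim M), M; split.
- exact: regression_lim_measurable.
- exact: regression_lim_ext.
- have Mge n : (n <= M n)%N.
    by elim: n => [//|n ih]; exact: leq_ltn_trans ih (MS n).
  apply/cvgnyPge => A; exists A => // n /= An; exact: leq_trans An (Mge n).
- exact: regression_lim_ae.
Qed.

End regression_limit.

(** * Recognizing Gaussian variables and independence by characteristic functions *)

Section gaussian_of_cf.
Context d (T : measurableType d) (R : realType) (M : probability T R).
Variables (X : T -> R).
Hypothesis mX : measurable_fun setT X.

(** A Dirac or normal law with the given mean and variance has the same
    characteristic function, so that it is the law of [X]. *)
Lemma gaussian_variable_of_cf (a v : R) : 0 <= v ->
  (forall t, \int[M]_x cos (t * (X x - a)) = expR (- (t ^+ 2 * v / 2))) ->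
  (forall t, \int[M]_x sin (t * (X x - a)) = 0) ->
  [/\ gaussian_real (pushforward M X),
      M.-integrable setT (fun x => (X x ^+ 2)%:E),
      (\int[M]_x (X x)%:E = a%:E)%E &
      (\int[M]_x (X x ^+ 2)%:E = (v + a ^+ 2)%:E)%E].
Proof.
move=> v0 hc hs.
have mcos := @measurable_cos R; have msin := @measurable_sin R.
have mXa t : measurable_fun setT (fun x => t * (X x - a)).
  by apply: measurable_funM => //; exact: measurable_funB.
have mt (t : R) : measurable_fun setT (fun y : R => t * y) by exact: measurable_funM.
have mta (t : R) : measurable_fun setT (fun y : R => t * (y - a)).
  by apply: measurable_funM => //; exact: measurable_funB.
have msqr : measurable_fun setT (fun y : R => y ^+ 2) by exact: measurable_funX.
(* centering at [a] multiplies the characteristic function by a factor that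
   does not depend on the law, hence centered characteristic functions
   determine the law as well *)
have key (N : probability (measurableTypeR R) R) :
    (forall t : R, \int[N]_y cos (t * (y - a)) = expR (- (t ^+ 2 * v / 2))) ->
    (forall t : R, \int[N]_y sin (t * (y - a)) = 0) ->
    forall B, measurable B -> M (X @^-1` B) = N B.
  move=> Nc Ns; have shift (P : probability (measurableTypeR R) R) :
      (forall t : R, \int[P]_y cos (t * (y - a)) = expR (- (t ^+ 2 * v / 2))) ->
      (forall t : R, \int[P]_y sin (t * (y - a)) = 0) -> forall t : R,
      (\int[P]_y (cos (t * y))%:E = (cos (t * a) * expR (- (t ^+ 2 * v / 2)))%:E)%E /\
      (\int[P]_y (sin (t * y))%:E = (sin (t * a) * expR (- (t ^+ 2 * v / 2)))%:E)%E.
    move=> Pc Ps t.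
    have ic := integrable_cos P (mta t); have is_ := integrable_sin P (mta t).
    have izc r := integrableZl measurableT r ic.
    have izs r := integrableZl measurableT r is_.
    have Ec : (\int[P]_y (cos (t * (y - a)))%:E = (expR (- (t ^+ 2 * v / 2)))%:E)%E.
      by rewrite -Pc EFin_Rintegral.
    have Es : (\int[P]_y (sin (t * (y - a)))%:E = 0)%E.
      by rewrite EFin_Rintegral// Ps.
    split.
      transitivity (\int[P]_y ((cos (t * a))%:E * (cos (t * (y - a)))%:E
          - (sin (t * a))%:E * (sin (t * (y - a)))%:E))%E.
        apply: eq_integral => y _; rewrite -!EFinM -EFinB; congr EFin.
        by rewrite -cosD; congr cos; ring.
      by rewrite integralB// !integralZl// Ec Es mule0 sube0 -EFinM.
    transitivity (\int[P]_y ((sin (t * a))%:E * (cos (t * (y - a)))%:E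
        + (cos (t * a))%:E * (sin (t * (y - a)))%:E))%E.
      apply: eq_integral => y _; rewrite -!EFinM -EFinD; congr EFin.
      by rewrite -sinD; congr sin; ring.
    by rewrite integralD// !integralZl// Ec Es mule0 adde0 -EFinM.
  pose L : probability (measurableTypeR R) R :=
    @law _ _ T (measurableTypeR R) R M X mX.
  have Lc t : \int[L]_y cos (t * (y - a)) = expR (- (t ^+ 2 * v / 2)).
    rewrite /Rintegral (@integral_law _ _ T (measurableTypeR R) _ _ _ mX
      (fun y => cos (t * (y - a)))).
    - exact: hc.
    - exact: (measurableT_comp mcos (mta t)).
    - exact: (integrable_cos M (mXa t)).
  have Ls t : \int[L]_y sin (t * (y - a)) = 0.
    rewrite /Rintegral (@integral_law _ _ T (measurableTypeR R) _ _ _ mX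
      (fun y => sin (t * (y - a)))).
    - exact: hs.
    - exact: (measurableT_comp msin (mta t)).
    - exact: (integrable_sin M (mXa t)).
  move=> B mB; rewrite -[LHS]/(L B).
  apply: (@cf_unique R L N) => // t.
    by rewrite (shift _ Lc Ls t).1 (shift _ Nc Ns t).1.
  by rewrite (shift _ Lc Ls t).2 (shift _ Nc Ns t).2.
have [vE|vN] := eqVneq v 0.
  have Xa : forall B, measurable B -> M (X @^-1` B) = \d_a B.
    pose N : probability (measurableTypeR R) R := \d_(a : measurableTypeR R).
    apply: (key N) => t.
      rewrite /Rintegral integral_dirac//; last first.
        by apply/measurable_EFinP; exact: (measurableT_comp mcos (mta t)).
      by rewrite diracT mul1e/= subrr mulr0 cos0 vE mulr0 mul0r oppr0 expR0.
    rewrite /Rintegral integral_dirac//; last first.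
      by apply/measurable_EFinP; exact: (measurableT_comp msin (mta t)).
    by rewrite diracT mul1e/= subrr mulr0 sin0.
  have [_ E1] := dirac_variable mX Xa (@measurable_id _ _ setT).
  have [i2 E2] := dirac_variable mX Xa msqr.
  split => //; first by left; exists a.
  by rewrite E2 vE add0r.
pose s := Num.sqrt v.
have s0 : 0 < s by rewrite sqrtr_gt0 lt_neqAle eq_sym vN.
have s_neq0 : s != 0 by rewrite gt_eqF.
have s2 : s ^+ 2 = v by rewrite sqr_sqrtr.
have XN : forall B, measurable B -> M (X @^-1` B) = normal_prob a s B.
  apply: key => t; first by rewrite -s2; exact: normal_cos.
  exact: normal_sin.
have mpow n : measurable_fun setT (fun y : R => (y - a) ^+ n).
  by apply: measurable_funX; exact: measurable_funB.
have D f := @same_law _ _ T (measurableTypeR R) R M X mX (normal_prob a s) f XN.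
have [i1 E1] := D _ (mpow 1%N) (@normal_integrable_pow R a s s_neq0 1%N isT).
have [i2 E2] := D _ (mpow 2%N) (@normal_integrable_pow R a s s_neq0 2%N isT).
rewrite normal_moment1// in E1; rewrite normal_moment2// in E2.
have E1' : (\int[M]_x ((X x - a) ^+ 1)%:E = 0)%E := E1.
have E2' : (\int[M]_x ((X x - a) ^+ 2)%:E = (s ^+ 2)%:E)%E := E2.
have ica c := finite_measure_integrable_cst M c (@measurableT _ T).
have i1' := integrableZl measurableT (2 * a) i1.
have iL := integrableD measurableT i1' (ica (a ^+ 2)).
have XE x : (X x ^+ 2)%:E = (((X x - a) ^+ 2)%:E +
    ((2 * a)%:E * ((X x - a) ^+ 1)%:E + (a ^+ 2)%:E))%E.
  by rewrite -EFinM -!EFinD; congr EFin; ring.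
have Ecst c : (\int[M]_x c%:E = c%:E)%E.
  rewrite integral_cst// [X in (_ * X)%E](_ : _ = 1%E) ?mule1//.
  exact: probability_setT.
split.
- by right; exists a, s.
- by apply: eq_integrable (integrableD measurableT i2 iL) => // x _; rewrite XE.
- under eq_integral => x _ do rewrite -[X x](subrK a) -[X x - a]expr1 EFinD.
  rewrite integralD//; last exact: ica.
  by rewrite E1' add0e Ecst.
- have EL : (\int[M]_x ((2 * a)%:E * ((X x - a) ^+ 1)%:E + (a ^+ 2)%:E) = (a ^+ 2)%:E)%E.
    by rewrite integralD//; [rewrite integralZl// E1' mule0 add0e Ecst|exact: ica].
  under eq_integral do rewrite XE.
  by rewrite integralD// EL E2' s2 -EFinD.
Qed.

End gaussian_of_cf.

Section independence.
Context d (T : measurableType d) (R : realType) (M : probability T R).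
Variables (H : hilbertType R) (X Y : T -> H).
Hypothesis H_dense : exists e : nat -> H, dense_seq setT e.
Hypothesis mX : measurable_fun setT (X : T -> borel H).
Hypothesis mY : measurable_fun setT (Y : T -> borel H).

Let mXY : measurable_fun setT (fun x => (X x, Y x) : borel H * borel H).
Proof. exact: measurable_fun_pair. Qed.

(** For centered Gaussian variables these two conditions say that the joint
    characteristic function is the product of the characteristic functions. *)
Hypothesis cosXY : forall h k,
  \int[M]_x cos (inner h (X x) + inner k (Y x)) =
  (\int[M]_x cos (inner h (X x))) * (\int[M]_x cos (inner k (Y x))).
Hypothesis sinXY : forall h k,
  \int[M]_x sin (inner h (X x) + inner k (Y x)) = 0.

Let sinX h : \int[M]_x sin (inner h (X x)) = 0.
Proof.
by rewrite -(sinXY h 0); apply: eq_Rintegral => x _; rewrite inner0l addr0.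
Qed.

Let sinY k : \int[M]_x sin (inner k (Y x)) = 0.
Proof.
by rewrite -(sinXY 0 k); apply: eq_Rintegral => x _; rewrite inner0l add0r.
Qed.

Definition prod_law : probability (borel H * borel H)%type R :=
  (law M mX \x law M mY)%E.

Let pairing (v : H * H) (z : borel H * borel H) : R :=
  inner v.1 z.1 + inner v.2 z.2.

Let mcos := @measurable_cos R.
Let msin := @measurable_sin R.

Let mpairing v : measurable_fun setT (pairing v).
Proof.
apply: measurable_funD.
  exact: (measurableT_comp (measurable_inner v.1) (@measurable_fst _ _ _ _)).
exact: (measurableT_comp (measurable_inner v.2) (@measurable_snd _ _ _ _)).
Qed.

Let law_cos (Z : T -> H) (mZ : measurable_fun setT (Z : T -> borel H)) h :
  (\int[law M mZ]_y (cos (inner h y))%:E = (\int[M]_x cos (inner h (Z x)))%:E)%E.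
Proof.
have mi := measurableT_comp (measurable_inner h) mZ.
rewrite (@integral_law _ _ _ _ _ _ _ mZ (fun y => cos (inner h y))).
- by rewrite EFin_Rintegral//; exact: (integrable_cos M mi).
- exact: (measurableT_comp mcos (measurable_inner h)).
- exact: (integrable_cos M mi).
Qed.

Let law_sin (Z : T -> H) (mZ : measurable_fun setT (Z : T -> borel H)) h :
  (\int[law M mZ]_y (sin (inner h y))%:E = (\int[M]_x sin (inner h (Z x)))%:E)%E.
Proof.
have mi := measurableT_comp (measurable_inner h) mZ.
rewrite (@integral_law _ _ _ _ _ _ _ mZ (fun y => sin (inner h y))).
- by rewrite EFin_Rintegral//; exact: (integrable_sin M mi).
- exact: (measurableT_comp msin (measurable_inner h)).
- exact: (integrable_sin M mi).
Qed.

Let prod_cos v : (\int[prod_law]_z (cos (pairing v z))%:E =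
  ((\int[M]_x cos (inner v.1 (X x))) * (\int[M]_x cos (inner v.2 (Y x))))%:E)%E.
Proof.
rewrite -(integral12_prod_meas1 (integrable_cos prod_law (mpairing v))).
have ic h := integrable_cos (law M mY) (measurable_inner h).
have is_ h := integrable_sin (law M mY) (measurable_inner h).
transitivity (\int[law M mX]_x ((\int[M]_x cos (inner v.2 (Y x)))%:E *
    (cos (inner v.1 x))%:E))%E.
  apply: eq_integral => x _; rewrite /fubini_F /pairing /=.
  transitivity (\int[law M mY]_y ((cos (inner v.1 x))%:E * (cos (inner v.2 y))%:E
      - (sin (inner v.1 x))%:E * (sin (inner v.2 y))%:E))%E.
    by apply: eq_integral => y _; rewrite cosD EFinB !EFinM.
  have iz r := integrableZl measurableT r (ic v.2).
  have iz' r := integrableZl measurableT r (is_ v.2).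
  rewrite integralB// !integralZl//.
  by rewrite law_cos law_sin sinY mule0 sube0 muleC.
rewrite integralZl//; last exact: (integrable_cos (law M mX) (measurable_inner v.1)).
by rewrite law_cos -EFinM mulrC.
Qed.

Let prod_sin v : (\int[prod_law]_z (sin (pairing v z))%:E = 0)%E.
Proof.
rewrite -(integral12_prod_meas1 (integrable_sin prod_law (mpairing v))).
have ic h := integrable_cos (law M mY) (measurable_inner h).
have is_ h := integrable_sin (law M mY) (measurable_inner h).
transitivity (\int[law M mX]_x ((\int[M]_x cos (inner v.2 (Y x)))%:E *
    (sin (inner v.1 x))%:E))%E.
  apply: eq_integral => x _; rewrite /fubini_F /pairing /=.
  transitivity (\int[law M mY]_y ((sin (inner v.1 x))%:E * (cos (inner v.2 y))%:E
      + (cos (inner v.1 x))%:E * (sin (inner v.2 y))%:E))%E.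
    by apply: eq_integral => y _; rewrite sinD EFinD !EFinM.
  have iz r := integrableZl measurableT r (ic v.2).
  have iz' r := integrableZl measurableT r (is_ v.2).
  rewrite integralD// !integralZl//.
  by rewrite law_cos law_sin sinY mule0 adde0 muleC.
rewrite integralZl//; last exact: (integrable_sin (law M mX) (measurable_inner v.1)).
by rewrite law_sin sinX mule0.
Qed.

(** The joint law and the product of the laws have the same characteristic
    function, and the functionals determine both components because the space
    is separable. *)
Lemma cf_independence (A : set (borel H * borel H)) : measurable A ->
  M [set x | A (X x, Y x)] = prod_law A.
Proof.
move=> mA.
have mpX v : measurable_fun setT (fun x => pairing v (X x, Y x)).
  exact: (measurableT_comp (mpairing v) mXY).
have [||||S [mS PQ]] := @trigonometric_unique _ _ R (H * H)%type
    (law M mXY) prod_law pairing.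
- by move=> a u v x; rewrite /pairing /= !innerDl !innerZl; ring.
- exact: mpairing.
- move=> v; rewrite prod_cos -cosXY.
  rewrite (@integral_law _ _ _ _ _ _ _ mXY (fun z => cos (pairing v z))).
  + by rewrite EFin_Rintegral//; exact: (integrable_cos M (mpX v)).
  + exact: (measurableT_comp mcos (mpairing v)).
  + exact: (integrable_cos M (mpX v)).
- move=> v; rewrite prod_sin.
  transitivity ((\int[M]_x sin (inner v.1 (X x) + inner v.2 (Y x)))%:E);
    last first.
    by rewrite sinXY.
  rewrite (@integral_law _ _ _ _ _ _ _ mXY (fun z => sin (pairing v z))).
  + by rewrite EFin_Rintegral//; exact: (integrable_sin M (mpX v)).
  + exact: (measurableT_comp msin (mpairing v)).
  + exact: (integrable_sin M (mpX v)).
rewrite -[LHS]/(law M mXY A); apply: PQ.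
have m1 : measurable_fun setT (fst : g_sigma_algebraType S -> borel H).
  apply: (@weakly_measurable R H _ (g_sigma_algebraType S) fst H_dense) => h.
  have := mS (h, 0); congr measurable_fun; apply/funext => z.
  by rewrite /pairing /= inner0l addr0.
have m2 : measurable_fun setT (snd : g_sigma_algebraType S -> borel H).
  apply: (@weakly_measurable R H _ (g_sigma_algebraType S) snd H_dense) => h.
  have := mS (0, h); congr measurable_fun; apply/funext => z.
  by rewrite /pairing /= inner0l add0r.
have := measurable_fun_pair m1 m2 measurableT mA; rewrite setTI.
by rewrite (_ : _ @^-1` A = A)//; apply/seteqP; split => -[].
Qed.

End independence.

(** * The conditional measures *)

Section gaussian_measure_of_cf.
Variables (R : realType) (H : hilbertType R) (N : probability (borel H) R).
Variables (a : H) (S : H -> H).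
Hypothesis S_linear : linear S.
Hypothesis S_sym : forall x y, inner (S x) y = inner x (S y).
Hypothesis S_ge0 : forall x, 0 <= inner (S x) x.
Hypothesis Ncos : forall h,
  \int[N]_y cos (inner h (y : H) - inner h a) = expR (- (inner (S h) h / 2)).
Hypothesis Nsin : forall h, \int[N]_y sin (inner h (y : H) - inner h a) = 0.

Let SZ (t : R) h : S (t *: h) = t *: S h.
Proof.
have S0 : S 0 = 0 by apply: inner_inj => y; rewrite S_sym !inner0l.
by rewrite -[t *: h]addr0 S_linear S0 addr0.
Qed.

Let SD x y : S (x + y) = S x + S y.
Proof. by rewrite -[x]scale1r S_linear !scale1r. Qed.

Let SB x y : S (x - y) = S x - S y.
Proof. by rewrite SD -[- y]scaleN1r SZ scaleN1r. Qed.

Let moments h : [/\ gaussian_real (pushforward N (fun x : H => inner h x)),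
  N.-integrable setT (fun x => (inner h (x : H) ^+ 2)%:E),
  (\int[N]_x (inner h (x : H))%:E = (inner h a)%:E)%E &
  (\int[N]_x (inner h (x : H) ^+ 2)%:E = (inner (S h) h + inner h a ^+ 2)%:E)%E].
Proof.
apply: (gaussian_variable_of_cf (measurable_inner h) (S_ge0 h)) => t.
  have := Ncos (t *: h); rewrite SZ innerZl innerZr mulrA -expr2 => <-.
  by apply: eq_Rintegral => y _; rewrite !innerZl mulrBr.
have := Nsin (t *: h) => <-.
by apply: eq_Rintegral => y _; rewrite !innerZl mulrBr.
Qed.

Lemma gaussian_measure_of_cf : gaussian_measure N /\ is_covariance N S.
Proof.
split; first by move=> h; have [] := moments h.
exists a; first by move=> h; have [] := moments h.
move=> h k; have [_ ip _ Ep] := moments (h + k);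
  have [_ im _ Em] := moments (h - k).
have -> : (\int[N]_x (inner h x * inner k x)%:E =
    (inner (S h) k + inner h a * inner k a)%:E)%E.
  transitivity (\int[N]_x ((4^-1)%:E * ((inner (h + k) x ^+ 2)%:E
      - (inner (h - k) x ^+ 2)%:E)))%E.
    apply: eq_integral => x _; rewrite -EFinB -EFinM innerDl innerBl;
      congr EFin.
    by field.
  rewrite integralZl//; last exact: integrableB.
  rewrite integralB// Ep Em -EFinB -EFinM; congr EFin.
  rewrite SD SB !(innerDl, innerDr, innerNl, innerNr).
  by rewrite [inner (S k) h]S_sym [inner k (S h)]innerC; field.
by rewrite -EFinB addrK.
Qed.

End gaussian_measure_of_cf.

Section orthogonal_projection.
Variables (R : realType) (H : hilbertType R) (H1 H2 : set H).
Hypothesis H12 : orthogonal_direct_sum H1 H2.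
Local Notation P := (orth_proj H2).

Lemma orth_projP x : H2 (P x) /\ forall z, H2 z -> inner (x - P x) z = 0.
Proof.
have [_ _ orth dec] := H12; have [y [w [Hy Hw ->]]] := dec x.
apply: (@xgetPex _ 0 [set v | H2 v /\ forall z, H2 z -> inner (y + w - v) z = 0]).
by exists w; split => // z Hz; rewrite addrK orth.
Qed.

Lemma orth_proj_inner z x : H2 z -> inner z (P x) = inner z x.
Proof.
move=> Hz; apply/esym/eqP; rewrite -subr_eq0 -innerBr innerC.
by have [_ ->] := orth_projP x.
Qed.

Lemma orth_proj_adj h x : inner h (P x) = inner (P h) x.
Proof.
have [hx _] := orth_projP x; have [hh _] := orth_projP h.
by rewrite -[RHS](orth_proj_inner _ hh) innerC -(orth_proj_inner _ hx) innerC.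
Qed.

Lemma orth_projB x y : P (x - y) = P x - P y.
Proof.
apply: inner_inj => h; rewrite [LHS]innerC orth_proj_adj innerBr.
by rewrite -!orth_proj_adj -innerBr innerC.
Qed.

Lemma orth_proj_measurable : (exists e, dense_seq [set: H] e) ->
  measurable_fun setT (P : borel H -> borel H).
Proof.
move=> de; apply: weakly_measurable => // h.
by under eq_fun do rewrite orth_proj_adj; exact: measurable_inner.
Qed.

End orthogonal_projection.

Section conditional_measures.
Variables (R : realType) (H : hilbertType R) (H1 H2 : set H).
Hypothesis H12 : orthogonal_direct_sum H1 H2.
Variable mu : probability (borel H) R.
Hypothesis gmu : gaussian_measure mu.
Variables (m : H) (C : H -> H).
Hypotheses (mean_mu : is_mean mu m) (cov_mu : is_covariance mu C).
Local Notation xi := (centered m).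
Local Notation b := (cov_form C).
Local Notation P := (orth_proj H2).
Hypothesis H_dense : exists e, dense_seq [set: H] e.
Variable d : nat -> H.
Hypothesis d_dense : dense_seq H2 d.
Local Notation k := (gs b d).
Local Notation S := (short_lim C d).

Let C_sym := cov_sym gmu mean_mu cov_mu.
Let C_linear := cov_linear gmu mean_mu cov_mu.
Let C_ge0 := cov_ge0 gmu mean_mu cov_mu.

Let moment2 : mu.-integrable setT (fun x => (`|(x : H) - m| ^+ 2)%:E).
Proof.
by have [e de] := H_dense; exact: (second_moment_integrable gmu mean_mu cov_mu de).
Qed.

Let C_le := cov_le gmu mean_mu cov_mu moment2.
Let Ck_sum := gs_variance_sum gmu mean_mu cov_mu d moment2.
Let S_short : is_short H1 C S :=
  short_lim_is_short H12 C_linear C_sym C_ge0 C_le d_dense Ck_sum.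

Let kH2 i : H2 (k i).
Proof. by have [_ cH2 _ _] := H12; apply: gs_mem => // n; exact: d_dense.1. Qed.

Variables (Lam : H -> H) (M : nat -> nat).
Hypothesis Lam_measurable :
  forall h, measurable_fun setT (fun w : borel H => inner h (Lam w)).
Hypothesis Lam_ext :
  forall w w', (forall i, inner (k i) w = inner (k i) w') -> Lam w = Lam w'.
Hypothesis M_oo : M @ \oo --> \oo.
Hypothesis Lam_ae : {ae mu, forall x : borel H, forall h : H,
  (fun n => xi (gs_res b d (M n) h) x) @ \oo -->
  inner h ((x : H) - m - Lam ((x : H) - m))}.

(** The part of [x - m] that its [H2]-component does not predict. *)
Definition innovation (x : H) : H := x - m - Lam (x - m).
Definition observation (x : H) : H := P (x - m).

Let LamP w : Lam (P w) = Lam w.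
Proof. by apply: Lam_ext => i; rewrite (orth_proj_inner H12). Qed.

Let innovation_measurable : measurable_fun setT (innovation : borel H -> borel H).
Proof.
apply: weakly_measurable => // h; rewrite /innovation.
under eq_fun do rewrite innerBr.
have mt := @translation_measurable R H m.
apply: measurable_funB; first exact: (measurableT_comp (measurable_inner h) mt).
exact: (measurableT_comp (Lam_measurable h) mt).
Qed.

Let observation_measurable : measurable_fun setT (observation : borel H -> borel H).
Proof.
have mP := orth_proj_measurable H12 H_dense.
exact: (measurableT_comp mP (@translation_measurable R H m)).
Qed.

Let inner_observation h x : inner h (observation x) = xi (P h) x.
Proof. by rewrite /observation (orth_proj_adj H12). Qed.

(** The functionals [<r_n h, x - m>] converge to [<h, z>] almost everywhere, and
    their variances to [<S h, h>]; adding an observed functional adds its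
    variance in the limit because [S h] is orthogonal to [H2]. *)
Let variance_cvg h g : H2 g ->
  (fun n => inner (C (gs_res b d (M n) h + g)) (gs_res b d (M n) h + g)) @ \oo -->
  inner (S h) h + inner (C g) g.
Proof.
move=> Hg.
have CD x y : C (x + y) = C x + C y by rewrite -[x]scale1r C_linear !scale1r.
have h1 := short_lim_form C_linear C_sym C_ge0 Ck_sum (h := h).
have h2 : (fun n => b (gs_res b d n h) g) @ \oo --> (0 : R).
  have <- : inner (S h) g = 0.
    exact: (short_lim_orth C_linear C_sym C_ge0 d_dense Ck_sum).
  exact: (short_limE C_linear Ck_sum).
rewrite (_ : inner (S h) h + _ = inner (S h) h + 2 * 0 + inner (C g) g);
  last by ring.
have -> : (fun n => inner (C (gs_res b d (M n) h + g)) (gs_res b d (M n) h + g)) =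
    (fun n => b (gs_res b d (M n) h) (gs_res b d (M n) h) +
              2 * b (gs_res b d (M n) h) g + inner (C g) g).
  apply/funext => n; rewrite CD innerDl !innerDr /cov_form.
  by rewrite [inner (C g) (gs_res _ _ _ _)]C_sym [inner g (C _)]innerC; ring.
apply: cvgD; last exact: cvg_cst.
apply: cvgD; first exact: (cvg_comp _ _ M_oo h1).
by apply: cvgM; [exact: cvg_cst|exact: (cvg_comp _ _ M_oo h2)].
Qed.

(** Dominated convergence along the subsequence on which the residues of
    [x - m] converge almost everywhere. *)
Let joint_limit (f : R -> R) (K : R) h g : continuous f ->
  (forall x, `|f x| <= K) ->
  (fun n => \int[mu]_x f (xi (gs_res b d (M n) h + g) x)) @ \oo -->
  \int[mu]_x f (inner h (innovation x) + xi g x).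
Proof.
move=> cf fK.
have mf : measurable_fun setT f by exact: continuous_measurable_fun.
have mi : measurable_fun setT (fun x : borel H => inner h (innovation x) + xi g x).
  apply: measurable_funD; last exact: measurable_centered.
  exact: (measurableT_comp (measurable_inner h) innovation_measurable).
apply: fine_cvg; rewrite -EFin_Rintegral; last first.
  by apply: (@bounded_integrable _ _ _ _ _ K) => //; exact: measurableT_comp.
have [|||||_ _] := @dominated_convergence _ _ _ mu setT measurableT
  (fun n x => (f (xi (gs_res b d (M n) h + g) x))%:E)
  (fun x => (f (inner h (innovation x) + xi g x))%:E) (fun=> K%:E) => //.
- move=> n; apply/measurable_EFinP; apply: measurableT_comp => //.
  exact: measurable_centered.
- by apply/measurable_EFinP; exact: measurableT_comp.
- move: Lam_ae; apply: filterS => x hx _; apply: cvg_EFin; first exact: nearW.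
  apply: (@continuous_cvg _ _ _ _ _ (fun n => xi (gs_res b d (M n) h + g) x) f).
    exact: cf.
  by under eq_fun do rewrite centeredD; apply: cvgD; [exact: hx|exact: cvg_cst].
- exact: finite_measure_integrable_cst.
- by apply: aeW => x n _; rewrite lee_fin.
Qed.

Let joint_cos h g : H2 g -> \int[mu]_x cos (inner h (innovation x) + xi g x) =
  expR (- ((inner (S h) h + inner (C g) g) / 2)).
Proof.
move=> Hg; have := @joint_limit cos 1 h g (@continuous_cos R) (@cos_max R) =>
  h1.
apply: (cvg_unique _ h1) => //.
have -> : (fun n => \int[mu]_x cos (xi (gs_res b d (M n) h + g) x)) =
    (fun n => expR (- (inner (C (gs_res b d (M n) h + g)) (gs_res b d (M n) h + g) / 2))).
  by apply/funext => n; rewrite (centered_cos gmu mean_mu cov_mu).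
apply: (@continuous_cvg _ _ _ _ _ _ expR); first exact: continuous_expR.
apply: cvgN; apply: cvgM; last exact: cvg_cst.
exact: variance_cvg.
Qed.

Let joint_sin h g : \int[mu]_x sin (inner h (innovation x) + xi g x) = 0.
Proof.
have := @joint_limit sin 1 h g (@continuous_sin R) (@sin_max R) => h1.
apply: (cvg_unique _ h1) => //.
have -> : (fun n => \int[mu]_x sin (xi (gs_res b d (M n) h + g) x)) = (fun=> 0).
  by apply/funext => n; rewrite (centered_sin gmu mean_mu cov_mu).
exact: cvg_cst.
Qed.

Let xi0 x : xi 0 x = 0. Proof. by rewrite /centered inner0l. Qed.

Let H20 : H2 0. Proof. by have [_ [_ + _] _ _] := H12. Qed.

Let C00 : inner (C 0) 0 = 0. Proof. by rewrite inner0r. Qed.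

Let innovation_cos h :
  \int[mu]_x cos (inner h (innovation x)) = expR (- (inner (S h) h / 2)).
Proof.
rewrite -[inner (S h) h]addr0 -C00 -joint_cos//.
by apply: eq_Rintegral => x _; rewrite xi0 addr0.
Qed.

Let innovation_sin h : \int[mu]_x sin (inner h (innovation x)) = 0.
Proof.
by rewrite -(joint_sin h 0); apply: eq_Rintegral => x _; rewrite xi0 addr0.
Qed.

(** Variances add up by [variance_cvg], so that the joint characteristic
    function factors. *)
Lemma innovation_independent (A : set (borel H * borel H)) : measurable A ->
  mu [set x | A (observation x, innovation x)] =
  prod_law mu observation_measurable innovation_measurable A.
Proof.
apply: cf_independence => // h g.
- under eq_Rintegral do rewrite inner_observation addrC.
  have Hh : H2 (P h) by have [] := orth_projP H12 h.
  rewrite joint_cos// innovation_cos.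
  under [X in _ = X * _]eq_Rintegral do rewrite inner_observation.
  by rewrite (centered_cos gmu mean_mu cov_mu) -expRD; congr expR; field.
- by under eq_Rintegral do rewrite inner_observation addrC; exact: joint_sin.
Qed.

(** [Lam (t - m)] is the regression of [x - m] for every [x] with
    [H2]-component [t], since [Lam] only reads coordinates along [H2]. *)
Definition conditional_mean (t : H) : H := m + Lam (t - m).

Let conditional_measurable : measurable_fun setT
  (fun p : borel H * borel H => (innovation p.1 + conditional_mean p.2 : H) : borel H).
Proof.
apply: (@weakly_measurable R H _ (borel H * borel H)%type
  (fun p => innovation p.1 + conditional_mean p.2)) => // h.
under eq_fun do rewrite innerDr [inner _ (conditional_mean _)]innerDr.
have mL : measurable_fun setT (fun t : borel H => inner h (Lam (t - m))).
  exact: (measurableT_comp (Lam_measurable h) (@translation_measurable R H m)).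
have mi : measurable_fun setT (fun x : borel H => inner h (innovation x)).
  exact: (measurableT_comp (measurable_inner h) innovation_measurable).
apply: measurable_funD.
  exact: (measurableT_comp mi (@measurable_fst _ _ _ _)).
apply: measurable_funD => //.
exact: (measurableT_comp mL (@measurable_snd _ _ _ _)).
Qed.

Let conditional_section t : measurable_fun setT
  (fun x : borel H => (innovation x + conditional_mean t : H) : borel H).
Proof.
have mp : measurable_fun setT (fun x : borel H => (x, t : borel H)).
  exact: measurable_fun_pair.
exact: (measurableT_comp conditional_measurable mp).
Qed.

(** Given the observation, [x] is a constant plus an innovation whose law does
    not depend on the observation. *)
Definition conditional_measure (t : H) : probability (borel H) R :=
  law mu (conditional_section t).

Lemma conditional_measure_gaussian t :
  gaussian_measure (conditional_measure t) /\
  is_covariance (conditional_measure t) (short H1 C).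
Proof.
rewrite (short_unique S_short).
have [[[[lS _] sS S0] _ _] _] := S_short.
have mi h : measurable_fun setT (fun y : borel H => inner h y - inner h (conditional_mean t)).
  by apply: measurable_funB => //; exact: measurable_inner.
have mii h : measurable_fun setT
    (fun x : borel H => inner h (innovation x + conditional_mean t) - inner h (conditional_mean t)).
  exact: (measurableT_comp (mi h) (conditional_section t)).
have mcos := @measurable_cos R; have msin := @measurable_sin R.
apply: (@gaussian_measure_of_cf _ _ _ (conditional_mean t)) => // h.
- rewrite -innovation_cos /Rintegral (@integral_law _ _ _ _ _ _ _ (conditional_section t)
    (fun y => cos (inner h y - inner h (conditional_mean t)))).
  + by congr fine; apply: eq_integral => x _; rewrite innerDr addrK.
  + exact: (measurableT_comp mcos (mi h)).
  + exact: (integrable_cos mu (mii h)).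
- rewrite -(innovation_sin h) /Rintegral (@integral_law _ _ _ _ _ _ _ (conditional_section t)
    (fun y => sin (inner h y - inner h (conditional_mean t)))).
  + by congr fine; apply: eq_integral => x _; rewrite innerDr addrK.
  + exact: (measurableT_comp msin (mi h)).
  + exact: (integrable_sin mu (mii h)).
Qed.

Let conditional_kernel (A : set (borel H)) : measurable A ->
  measurable_fun setT (fun t : borel H => conditional_measure t A).
Proof.
move=> mA.
have mE := conditional_measurable measurableT mA; rewrite setTI in mE.
have := measurable_fun_ysection mu mE; congr measurable_fun.
apply/funext => t; rewrite /= ysectionE; congr (mu _).
Qed.

(** As [x] is a function of the observation and of the innovation, which are
    independent, the probability of an event is computed by integrating over
    the innovation first, with the observation fixed. *)
Lemma conditional_measure_rcp :
  regular_conditional_probability mu H2 conditional_measure.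
Proof.
split => [A mA|A B mA mB BH2].
  exact: measurable_funTS (conditional_kernel mA).
have mP := orth_proj_measurable H12 H_dense.
(* [x] is [p.2 + (m + Lam p.1)] and its [H2]-component is [p.1 + P m], where
   [p] is the pair of the observation and the innovation at [x] *)
pose F := [set p : borel H * borel H | A (p.2 + (m + Lam p.1)) /\ B (p.1 + P m)].
have mF : measurable F.
  have m1 : measurable_fun setT
      (fun p : borel H * borel H => (p.2 + (m + Lam p.1) : H) : borel H).
    apply: (@weakly_measurable R H _ (borel H * borel H)%type
      (fun p => p.2 + (m + Lam p.1))) => // h.
    under eq_fun do rewrite !innerDr.
    apply: measurable_funD.
      exact: (measurableT_comp (measurable_inner h) (@measurable_snd _ _ _ _)).
    apply: measurable_funD => //.
    exact: (measurableT_comp (Lam_measurable h) (@measurable_fst _ _ _ _)).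
  have m2 : measurable_fun setT
      (fun p : borel H * borel H => (p.1 - (- P m) : H) : borel H).
    exact: (measurableT_comp (@translation_measurable R H (- P m)) (@measurable_fst _ _ _ _)).
  have -> : F = (setT `&` (fun p : borel H * borel H => p.2 + (m + Lam p.1)) @^-1` A) `&`
      (setT `&` (fun p : borel H * borel H => p.1 - (- P m)) @^-1` B).
    by rewrite !setTI; apply/seteqP; split => p /=; rewrite opprK.
  by apply: measurableI; [exact: m1|exact: m2].
have mean_obs x : conditional_mean (P x) = m + Lam (observation x).
  congr (m + _); apply: Lam_ext => i; rewrite innerBr.
  by rewrite (orth_proj_inner H12 _ (kH2 i)) -innerBr /observation (orth_proj_inner H12).
have obsE x : observation x + P m = P x by rewrite /observation (orth_projB H12) subrK.
have innE x : innovation x + (m + Lam (observation x)) = x.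
  by rewrite /observation LamP /innovation addrCA subrK addrC subrK.
have -> : mu (A `&` P @^-1` B) = mu [set x | F (observation x, innovation x)].
  by congr (mu _); apply/seteqP; split => x; rewrite /F /= innE obsE.
rewrite innovation_independent//.
rewrite ge0_integral_pushforward//=; last first.
  exact: measurable_funTS (conditional_kernel mA).
rewrite /prod_law /product_measure1 ge0_integral_pushforward//=; last first.
  exact: measurable_fun_xsection.
rewrite [RHS]integral_mkcond; apply: eq_integral => x _.
rewrite patchE; case: ifPn => [/set_mem xB|xB].
  rewrite /= [LHS]lawE [RHS]lawE; congr (mu _).
  rewrite xsectionE /F mean_obs; apply/seteqP; split => x' /=;
    last by rewrite obsE.
  by case.
rewrite /= [LHS]lawE [X in mu X](_ : _ = set0) ?measure0//.
apply/seteqP; split => // x' /=; rewrite xsectionE /F /= obsE => -[_ PxB].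
by move: xB; rewrite notin_setE.
Qed.

End conditional_measures.

Theorem theorem2p1 (R : realType) (H : hilbertType R) (H1 H2 : set H)
    (H12 : orthogonal_direct_sum H1 H2)
    (sepH1 : separable H1) (sepH2 : separable H2)
    (mu : probability (borel H) R) (gmu : gaussian_measure mu)
    (m : H) (mean_mu : is_mean mu m)
    (C : H -> H) (cov_mu : is_covariance mu C) :
  exists mu_ : H -> probability (borel H) R,
    regular_conditional_probability mu H2 mu_ /\
    forall t : H, H2 t ->
      gaussian_measure (mu_ t) /\ is_covariance (mu_ t) (short H1 C).
Proof.
have [[_ H10 _] [_ H20 _] _ dec] := H12.
have [d1 d1_dense] := separable_dense_seq H10 sepH1.
have [d d_dense] := separable_dense_seq H20 sepH2.
have [e e_dense] := dense_seq_add d1_dense d_dense dec.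
have H_dense : exists e, dense_seq [set: H] e by exists e.
have moment2 := second_moment_integrable gmu mean_mu cov_mu e_dense.
have [Lam [M [mLam extLam Moo aeLam]]] :=
  regression_limit gmu mean_mu cov_mu d moment2.
exists (conditional_measure mu m H_dense mLam); split.
  exact: (conditional_measure_rcp H12 gmu mean_mu cov_mu H_dense d_dense mLam extLam Moo aeLam).
move=> t _.
exact: (conditional_measure_gaussian H12 gmu mean_mu cov_mu H_dense d_dense mLam Moo aeLam).
Qed.
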